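(* Let $n\ge2$, $w\in\mathbb{C}\setminus\{0\}$, $\lambda\in\mathbb{C}$ with $0<|\lambda|<1$, and let $A$ be the attractor of the IFS $\{f_k\}_{k=0}^{n-1}$, $f_k(z)=\lambda z+(n-2k-1)w$. Let $\phi$ and $\alpha$ be such that $\arg(\lambda)=2\pi\phi$ and $\arg(w)=2\pi\alpha$. (I) If $\phi=p/q$ with coprime integers $p$ and $q$ ($q\ge1$), let $b$ be such that $2b=\operatorname{lcm}(2,q)$, set $d=\gcd(2,q)$, and define $$\Theta=\left\{k\phi+\left(m+\tfrac12\right)\tfrac12+\alpha \bmod 1 \;:\; 0\le k\le b-1,\ m\in\{0,1\}\right\}.$$ Then: (1) the convex hull of $A$ is a polygon with $2b$ sides at the angles of $\Theta$. (2) The set $\operatorname{ext}(A)$ of extreme points of $A$ is given by (is the union of the entries of) the unique vector of non-empty compact sets $\{B_j\}_{j=0}^{2b-1}$ which solves the following system: for $m=0$ and $m=1$, $$B_{mb}=\bigcup_{j=0}^{n-1}f_j(B_{mb-2p/d}),\qquad B_k=f_{n-1+m}(B_{k-2p/d})\quad\text{for } mb<k<(m+1)b,$$ where the indices of the sets are taken modulo $2b$ and those of the maps modulo $n$. (3) If $A$ is convex, then $|\lambda|\ge n^{-1/b}$ and the system of equations in (2) identifies the itineraries of the points on $\partial A$. (II) If $\phi\notin\mathbb{Q}$, then: (1) the convex hull of $A$ is not a polygon; (2) $A$ is not convex.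
   Context: The attractor $A$ of $\{f_k\}$ is the unique non-empty compact set with $A=\bigcup_k f_k(A)$. $\operatorname{ext}(A)$ denotes $A\cap\partial\operatorname{conv}(A)$ (all points of $A$ on the boundary of its convex hull, not only vertices). A side is ''at angle $\theta$'' if its outward normal vector has argument $2\pi\theta$; angles are in turns, modulo $1$. A segment (the degenerate case, $b=1$) is regarded as a polygon with two sides having opposite outward normals. An itinerary of a point $x\in A$ is a sequence $w_0w_1w_2\cdots\in\{0,\dots,n-1\}^{\mathbb{N}}$ with $x=\lim_{k\to\infty}(f_{w_0}\circ\cdots\circ f_{w_k})(z)$ (any $z$); the system of equations identifies the itineraries obtained by following its equations, i.e. infinite paths in the directed graph with an edge labelled $i$ from $B_u$ to $B_v$ whenever $f_i(B_v)$ appears in the equation for $B_u$. *)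

(* Defs.v *)
From HB Require Import structures.
From mathcomp Require Import all_boot all_order all_algebra.
From mathcomp Require Import all_classical all_reals all_analysis.
From mathcomp Require Import complex.

Set Implicit Arguments.
Unset Strict Implicit.
Unset Printing Implicit Defensive.

Import Order.TTheory GRing.Theory Num.Theory numFieldNormedType.Exports.

Local Open Scope classical_set_scope.
Local Open Scope complex_scope.
Local Open Scope ring_scope.

(* The complex plane is (R[i])^o: this is the form of R[i] on which the
   analysis library puts the usual topology. *)

(* e^(2 i pi t): angles are measured in turns. *)
Definition cis (R : realType) (t : R) : (R[i])^o :=
  cos (2 * pi * t) +i* sin (2 * pi * t).

(* Representative in [0, 1[ of an angle modulo 1. *)
Definition mod1 (R : realType) (t : R) : R := t - (Num.floor t)%:~R.

Definition boundary (T : topologicalType) (S : set T) : set T :=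
  closure S `\` interior S.

(* Rcomplex R is R[i] as a real vector space, so that the weights in convex
   combinations are real. *)
Definition convexC (R : realType) (S : set (R[i])^o) : Prop :=
  @convex_set R (Rcomplex R) S.

Definition conv_hull (R : realType) (S : set (R[i])^o) : set (R[i])^o :=
  smallest (@convexC R) S.

Definition ext (R : realType) (A : set (R[i])^o) : set (R[i])^o :=
  A `&` boundary (conv_hull A).

(* Nondegenerate segments are polygons; single points are not. *)
Definition is_polygon (R : realType) (S : set (R[i])^o) : Prop :=
  exists s : seq (R[i])^o,
    [/\ uniq s, (1 < size s)%N & S = conv_hull [set` s]].

Definition dotC (R : realType) (u z : (R[i])^o) : R :=
  complex.Re u * complex.Re z + complex.Im u * complex.Im z.

(* The points of S on its supporting line with outward normal [cis t]. *)
Definition face (R : realType) (S : set (R[i])^o) (t : R) : set (R[i])^o :=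
  [set x | S x /\ forall y, S y -> dotC (cis t) y <= dotC (cis t) x].

(* A face is a side when it is not reduced to a point. Sides are counted by
   their outward normals, so a segment has two of them, with opposite
   normals. *)
Definition side_angles (R : realType) (S : set (R[i])^o) : set R :=
  [set t | 0 <= t < 1 /\ exists x y, [/\ face S t x, face S t y & x != y]].

Definition polygon_with_side_angles (R : realType) (S : set (R[i])^o)
    (N : nat) (Theta : set R) : Prop :=
  [/\ is_polygon S, side_angles S = Theta & (side_angles S #= `I_N)%card].

Section IFS.
Variables (R : realType) (n : nat) (f : nat -> (R[i])^o -> (R[i])^o).

(* For contractions f_0, ..., f_(n-1) and 0 < n there is exactly one such
   set. *)
Definition is_attractor (A : set (R[i])^o) : Prop :=
  [/\ A !=set0, compact A & A = \bigcup_(k in `I_n) f k @` A].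

(* The k-th term of the sequence is f_(s 0) (f_(s 1) ( ... (f_(s k) z))). *)
Definition is_itinerary (s : nat -> 'I_n) (x : (R[i])^o) : Prop :=
  forall z : (R[i])^o,
    foldr (fun i : 'I_n => f i) z (mkseq s k.+1) @[k --> \oo] --> x.

(* The indices of the unknowns live in the integers modulo 2 b; this is the
   intended ring because 2 b >= 2 whenever b > 0. The shift c stands for
   2 p / d. *)
Variables (b : nat) (c : 'Z_(2 * b)).

Definition solves_system (B : 'Z_(2 * b) -> set (R[i])^o) : Prop :=
  forall m : nat, (m < 2)%N ->
    B (m * b)%:R = \bigcup_(j in `I_n) f j @` B ((m * b)%:R - c) /\
    forall k : nat, (m * b < k < m.+1 * b)%N ->
      B k%:R = f ((n - 1 + m) %% n)%N @` B (k%:R - c).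

Definition compact_solution (B : 'Z_(2 * b) -> set (R[i])^o) : Prop :=
  (forall j, B j !=set0 /\ compact (B j)) /\ solves_system B.

(* There is an edge labelled i from u to v when f_i (B_v) appears in the
   equation of [solves_system] for B_u. *)
Definition system_edge (u : 'Z_(2 * b)) (i : 'I_n) (v : 'Z_(2 * b)) : Prop :=
  exists2 m : nat, (m < 2)%N &
    (u = (m * b)%:R /\ v = (m * b)%:R - c) \/
    (exists k : nat, [/\ (m * b < k < m.+1 * b)%N, u = k%:R,
      val i = ((n - 1 + m) %% n)%N & v = k%:R - c]).

Definition system_itinerary (s : nat -> 'I_n) : Prop :=
  exists v : nat -> 'Z_(2 * b), forall j, system_edge (v j) (s j) (v j.+1).

End IFS.

Definition ifs (R : realType) (n : nat) (lam w : (R[i])^o) (k : nat)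
    (z : (R[i])^o) : (R[i])^o :=
  lam * z + (n%:R - 2 * k%:R - 1) * w.

Definition Theta (R : realType) (b : nat) (phi alpha : R) : set R :=
  [set mod1 (k%:R * phi + (m%:R + 2^-1) * 2^-1 + alpha)
    | k in `I_b & m in `I_2].

(* Main.v *)
(* For a direction t, the face of A (its points maximizing <cis t, .>) is the
   union of the f_k (face A (t - phi)) over the digits k that maximize
   (n - 2k - 1) cos (2 pi (t - alpha)).  Hence the j-th digit of a point of the
   face is forced unless cos (2 pi (t - j phi - alpha)) = 0, and the face is a
   side if and only if this cosine vanishes for some j.

   When phi = p/q this happens exactly at the 2b grid angles
   alpha + 1/4 + j/(2b), and the system of equations is the face recursion at
   these angles; its compact solution is unique by contraction.  Between two
   consecutive grid angles the face is a single vertex.  A point y satisfying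
   the inequalities of all sides lies in a triangle (0, v_j, v_(j+1)) of
   consecutive vertices, where j is an index at which the cross product of v_j
   and y changes sign; so the sides bound exactly the hull of the vertices.

   If A is convex, so is its side parallel to w, which is made of n translates
   of a copy of such a side scaled by |lam|^b: these must overlap, so
   n |lam|^b >= 1.  When phi is irrational the same side consists of n points,
   so A is not convex, and there are infinitely many side directions. *)

Require Import Defs.
From HB Require Import structures.
From mathcomp Require Import all_boot all_order all_algebra.
From mathcomp Require Import all_classical all_reals all_analysis.
From mathcomp Require Import complex.
From mathcomp Require Import zify ring lra.

Import Order.TTheory GRing.Theory Num.Theory numFieldNormedType.Exports.
Import Normc.

Local Open Scope classical_set_scope.
Local Open Scope complex_scope.
Local Open Scope ring_scope.

Set Implicit Arguments.
Unset Strict Implicit.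
Unset Printing Implicit Defensive.

(** * Angles in turns *)

Section Plane.
Variable R : realType.
Local Notation C := (R[i])^o.
Implicit Types (x y z u : C) (s t : R).

Lemma dotCD u x y : dotC u (x + y) = dotC u x + dotC u y.
Proof. case: u x y => [a b] [c d] [e f]; rewrite /dotC /=; ring. Qed.

Lemma dotCN u x : dotC u (- x) = - dotC u x.
Proof. case: u x => [a b] [c d]; rewrite /dotC /=; ring. Qed.

Lemma dotCB u x y : dotC u (x - y) = dotC u x - dotC u y.
Proof. by rewrite dotCD dotCN. Qed.

Lemma dotCZ u a x : dotC u (a%:C * x) = a * dotC u x.
Proof. case: u x => [b c] [d e]; rewrite /dotC /=; ring. Qed.

Lemma dotC0 u : dotC u 0 = 0.
Proof. by rewrite /dotC /= !mulr0 addr0. Qed.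

Lemma dotC_cis s t : dotC (cis s) (cis t) = cos (2 * pi * (s - t)).
Proof. by rewrite mulrBr cosB /dotC /cis /=; ring. Qed.

Lemma dotC_rot s t x : dotC (cis t) (cis s * x) = dotC (cis (t - s)) x.
Proof.
case: x => a b; rewrite /dotC /cis /=.
have [-> ->] :
    cos (2 * pi * (t - s)) = cos (2 * pi * t) * cos (2 * pi * s) +
      sin (2 * pi * t) * sin (2 * pi * s) /\
    sin (2 * pi * (t - s)) = sin (2 * pi * t) * cos (2 * pi * s) -
      cos (2 * pi * t) * sin (2 * pi * s).
  by rewrite mulrBr cosB sinB.
ring.
Qed.

Lemma cos2piD (t : R) (k : int) : cos (2 * pi * (t + k%:~R)) = cos (2 * pi * t).
Proof.
have E (m : nat) (u : R) : cos (2 * pi * (u + m%:R)) = cos (2 * pi * u).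
  rewrite -[RHS](periodicn (@cosD2pi R) m); congr cos.
  by rewrite -[(pi *+ 2) *+ m]mulr_natr -[pi *+ 2]mulr_natr; ring.
case: k => k; first by rewrite E.
by rewrite NegzE mulrNz -(E k.+1) subrK.
Qed.

Lemma sin2piD (t : R) (k : int) : sin (2 * pi * (t + k%:~R)) = sin (2 * pi * t).
Proof.
have E v : sin (2 * pi * v) = cos (2 * pi * (v - 4^-1)) :> R.
  by rewrite -cosBpihalf; congr cos; field.
by rewrite !E -(cos2piD (t - _) k); congr (cos (_ * _)); ring.
Qed.

Lemma cisDz t (k : int) : cis (t + k%:~R) = cis t :> C.
Proof. by rewrite /cis cos2piD sin2piD. Qed.

Lemma cisDhalf t : cis (t + 2^-1) = - cis t :> C.
Proof.
rewrite /cis (_ : 2 * pi * _ = 2 * pi * t + pi); last by field.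
by rewrite cosDpi sinDpi.
Qed.

Lemma cos2pi_gt0 t : - 4^-1 < t -> t < 4^-1 -> 0 < cos (2 * pi * t) :> R.
Proof.
move=> t1 t2; apply: cos_gt0_pihalf.
have p0 := @pi_gt0 R.
rewrite (_ : - (pi / 2) = 2 * pi * (- 4^-1)); last by field.
rewrite (_ : pi / 2 = 2 * pi * 4^-1); last by field.
by rewrite !ltr_pM2l ?mulr_gt0 // t1 t2.
Qed.

Lemma cos2pi_lt0 t : 4^-1 < t -> t < 3 / 4 -> cos (2 * pi * t) < 0 :> R.
Proof.
move=> t1 t2; rewrite -oppr_gt0 -cosDpi.
rewrite (_ : _ + pi = 2 * pi * ((t - 2^-1) + 1%:~R)); last by field.
by rewrite cos2piD; apply: cos2pi_gt0; lra.
Qed.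

Lemma cos2pi_quarter : cos (2 * pi * 4^-1) = 0 :> R.
Proof. by rewrite (_ : 2 * pi * 4^-1 = pi / 2) ?cos_pihalf //; field. Qed.

Lemma cos2pi_half_add t (k : int) :
  cos (2 * pi * (t + k%:~R / 2)) = (-1) ^ k * cos (2 * pi * t) :> R.
Proof.
have E (m : int) (u : R) : cos (2 * pi * (u + (m%:~R + 1) / 2)) = 
    - cos (2 * pi * (u + m%:~R / 2)).
  by rewrite -cosDpi; congr cos; field.
elim/int_ind: k => [|k IH|k IH]; first by rewrite mul0r addr0 expr0z mul1r.
  by rewrite intS rmorphD /= (addrC 1) E IH exprzDr ?unitrN1 // expr1z; ring.
have := E (- k.+1%:Z) t.
rewrite (_ : - k.+1%:Z%:~R + 1 = (- k%:Z)%:~R :> R); last first.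
  by rewrite intS !(rmorphD,rmorphN) /=; ring.
rewrite IH => /(congr1 -%R); rewrite opprK => <-.
rewrite intS opprD exprzDr ?unitrN1 //.
by rewrite (_ : (-1) ^ (-1) = -1 :> R) ?mulN1r ?mulNr // exprN1 invrN1.
Qed.

Lemma cos2pi_eq0 t : cos (2 * pi * t) = 0 -> exists k : int, t = 4^-1 + k%:~R / 2 :> R.
Proof.
(* Subtracting [k / 2] brings [t] into [-1/4, 1/4), where the cosine vanishes only at the left
   end. *)
pose k : int := Num.floor (2 * (t + 4^-1)).
have [k1 k2] : k%:~R <= 2 * (t + 4^-1) /\ 2 * (t + 4^-1) < k%:~R + 1.
  split; first exact: Num.Theory.floor_le.
  by have := floorD1_gt (2 * (t + 4^-1)); rewrite rmorphD /=.
have -> : t = (t - k%:~R / 2) + k%:~R / 2 by field.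
rewrite cos2pi_half_add => /eqP; rewrite mulf_eq0 expfz_eq0 oppr_eq0 oner_eq0 andbF /=.
have [h|h] : t - k%:~R / 2 = - 4^-1 \/ - 4^-1 < t - k%:~R / 2.
- by case: (ltP (- 4^-1) (t - k%:~R / 2)); [right|left; lra].
- by move=> _; exists (k - 1); rewrite h rmorphB /=; field.
- by rewrite gt_eqF // cos2pi_gt0 //; lra.
Qed.

Lemma mod1_itv (t : R) : 0 <= mod1 t < 1.
Proof.
by have := floor_itv t; rewrite /mod1 rmorphD /= => /andP[]; lra.
Qed.

Lemma mod1_id (s t : R) (z : int) : 0 <= t < 1 -> t = s + z%:~R -> t = mod1 s.
Proof.
move=> /andP[t0 t1] tE; suff -> : mod1 s = s + z%:~R by [].
congr (_ + _); rewrite (@floor_def _ _ (- z)) ?rmorphN ?opprK //.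
by rewrite !rmorphD !rmorphN /=; lra.
Qed.

Lemma mod1_eq (s t : R) : mod1 s = mod1 t -> exists z : int, s - t = z%:~R.
Proof.
move=> st; exists (Num.floor s - Num.floor t).
by move: st; rewrite /mod1 rmorphB /=; lra.
Qed.

End Plane.

(** * Topology and convexity of the complex plane *)

Section Metric.
Variable R : realType.
Local Notation C := (R[i])^o.
Implicit Types (x y z u : C) (s t a : R) (S K : set C).

Lemma convexCP S : convexC S <-> forall x y a, S x -> S y -> 0 <= a <= 1 ->
  S (a%:C * x + (1 - a)%:C * y).
Proof.
have E x y (p : {i01 R}) : conv p (x : convex_lmodType (Rcomplex R)) y
    = (p%:num)%:C * x + (1 - p%:num)%:C * y :> C.
  case: x y => [a b] [c d]; apply/eqP; rewrite eq_complex /=.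
  by apply/andP; split; apply/eqP; rewrite /unstable.onem; ring.
split=> [cS x y a Sx Sy /andP[a0 a1]|cS x y p].
  pose p : {i01 R} := Itv01 a0 a1.
  have := cS x y p (mem_set Sx) (mem_set Sy).
  by rewrite E inE.
rewrite !inE => Sx Sy; rewrite E; apply: cS => //.
by apply/andP; split.
Qed.

Lemma convex_halfplane u h : convexC [set z : C | dotC u z <= h].
Proof.
apply/convexCP => x y a /= xh yh /andP[a0 a1].
rewrite dotCD !dotCZ.
have := ler_wpM2l a0 xh; have := ler_wpM2l (_ : 0 <= 1 - a) yh.
by rewrite subr_ge0 => /(_ a1); lra.
Qed.

Lemma convex_conv_hull S : convexC (conv_hull S).
Proof.
apply/convexCP => x y a Sx Sy a01 K [cK SK].
by move/convexCP: (cK); apply => //; [apply: Sx|apply: Sy].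
Qed.

Lemma sub_conv_hull S : S `<=` conv_hull S.
Proof. exact: sub_smallest. Qed.

Lemma conv_hull_sub S K : convexC K -> S `<=` K -> conv_hull S `<=` K.
Proof. exact: smallest_sub. Qed.

Lemma conv_hull_id S : convexC S -> conv_hull S = S.
Proof. by move=> cS; apply/seteqP; split; [exact: conv_hull_sub|exact: sub_conv_hull]. Qed.

(** Cauchy-Schwarz against a unit vector, by Lagrange's identity: the squared norm is the squared
    dot product plus the squared cross product. *)
Lemma dotC_normc_le t z : dotC (cis t) z <= normc z.
Proof.
case: z => a b; rewrite /dotC /=.
apply: (le_trans (ler_norm _)); rewrite -sqrtr_sqr ler_wsqrtr //.
have := cos2Dsin2 (2 * pi * t).
set c := cos _; set s := sin _ => cs.
have := sqr_ge0 (c * b - s * a).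
suff -> : a ^+ 2 + b ^+ 2 = (c * a + s * b) ^+ 2 + (c * b - s * a) ^+ 2 by lra.
by rewrite -[LHS]mul1r -cs; ring.
Qed.

Lemma normc_cis t : normc (cis t : C) = 1.
Proof. by rewrite /= cos2Dsin2 sqrtr1. Qed.

Lemma normcZ a z : 0 <= a -> normc (a%:C * z : C) = a * normc z.
Proof.
by move=> a0; rewrite normcM /= expr0n /= addr0 sqrtr_sqr ger0_norm.
Qed.

Lemma normc_ge0 z : 0 <= normc z.
Proof. by case: z => a b; rewrite sqrtr_ge0. Qed.

Lemma normc_triangle x y : normc (x + y : C) <= normc x + normc y.
Proof. exact: le_normcD. Qed.

Lemma normc_opp z : normc (- z : C) = normc z.
Proof. exact: normcN. Qed.

Lemma normc_dist x y : normc (x - y : C) = normc (y - x : C).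
Proof. by rewrite -normc_opp opprB. Qed.

Lemma normrE z : `|z| = (normc z)%:C.
Proof. by case: z. Qed.

(** Radii of balls in [R[i]] are themselves complex; a positive complex number has zero imaginary
    part, so real radii suffice. *)
Lemma nbhs_normc x (V : set C) : nbhs x V <->
  exists2 e : R, 0 < e & forall y, normc (x - y : C) < e -> V y.
Proof.
split=> [/nbhs_ballP|] [e /= e0 eV].
  exists (complex.Re e); first by case: e e0 {eV} => a b /=; rewrite ltcE /= => /andP[].
  move=> y xy; apply: eV; rewrite -ball_normE /= normrE.
  case: e e0 xy => a b /=; rewrite !ltcE /= => /andP[/eqP -> a0] ->.
  by rewrite eqxx.
apply/nbhs_ballP; exists e%:C; first by rewrite /= ltcR.
by move=> y; rewrite -ball_normE /= normrE ltcR; exact: eV.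
Qed.

Lemma closed_approx S x : closed S ->
  (forall e, 0 < e -> exists2 y, S y & normc (x - y : C) < e) -> S x.
Proof.
move=> cS xS; apply: cS => V /nbhs_normc[e e0 eV].
have [y Sy xy] := xS _ e0.
by exists y; split => //; exact: eV.
Qed.

Lemma lipschitz_continuous (F : C -> R) (k : R) :
  (forall x y, `|F x - F y| <= k * normc (x - y : C)) -> continuous F.
Proof.
move=> Fk x V /nbhs_ballP[e /= e0 eV].
(* [|k| + 1] is a positive substitute for [k], which may be zero or negative. *)
have k1 : 0 < `|k| + 1 by rewrite ltr_wpDl.
apply/nbhs_normc; exists (e / (`|k| + 1)); first by rewrite divr_gt0.
move=> y; rewrite ltr_pdivlMr // => xy; apply: eV; rewrite /ball /=.
apply: le_lt_trans (Fk _ _) (le_lt_trans _ xy).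
rewrite mulrC ler_wpM2l ?normc_ge0 //.
by rewrite (le_trans (ler_norm _)) // lerDl.
Qed.

Lemma dotC_continuous t : continuous (dotC (cis t) : C -> R).
Proof.
apply: (@lipschitz_continuous _ 1) => x y; rewrite mul1r -dotCB ler_norml.
by rewrite dotC_normc_le andbT lerNl -dotCN -normc_opp dotC_normc_le.
Qed.

Lemma normc_continuous : continuous (@normc R : C -> R).
Proof.
apply: (@lipschitz_continuous _ 1) => x y; rewrite mul1r ler_norml.
have := normc_triangle (x - y) y; have := normc_triangle (y - x) x.
by rewrite !subrK (normc_dist y x) => h1 h2; apply/andP; split; lra.
Qed.

Lemma complex_hausdorff : hausdorff_space C.
Proof. exact: norm_hausdorff. Qed.

Lemma compact_normc_bounded K : compact K ->
  exists2 D : R, 0 <= D & forall x, K x -> normc x <= D.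
Proof.
move=> cK; have [->|/set0P K0] := eqVneq K set0; first by exists 0.
have [c _ cP] := compact_EVT_max K0 cK
  (continuous_subspaceT (@normc_continuous)).
by exists (normc c) => [|x Kx]; [exact: normc_ge0|apply/cP/mem_set].
Qed.

Lemma geom_lt (r D e : R) : 0 <= r < 1 -> 0 < e -> exists m : nat, r ^+ m * D < e.
Proof.
move=> /andP[r0 r1] e0.
have /cvgrPdist_lt /(_ (e / (`|D| + 1))) : (GRing.exp r : R ^nat) @ \oo --> (0:R).
  by apply: cvg_expr; rewrite ger0_norm.
have D1 : 0 < `|D| + 1 by rewrite ltr_wpDl.
rewrite divr_gt0 // => /(_ isT) [m _ /(_ m (leqnn m))] /=.
rewrite sub0r normrN ltr_pdivlMr // => h.
exists m; apply: le_lt_trans h.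
rewrite ger0_norm ?exprn_ge0 // ler_wpM2l ?exprn_ge0 //.
by rewrite (le_trans (ler_norm _)) // lerDl.
Qed.

Lemma le_geom (r D E x : R) : 0 <= r < 1 ->
  (forall m, x <= E + r ^+ m * D) -> x <= E.
Proof.
move=> r01 h; apply/ler_addgt0Pr => e e0.
by have [m me] := geom_lt D r01 e0; apply: le_trans (h m) _; rewrite lerD2l ltW.
Qed.

End Metric.

(** * Orthonormal frames, cross products and faces of convex hulls *)

Section Convex.
Variable R : realType.
Local Notation C := (R[i])^o.
Implicit Types (x y z u : C) (s t a : R) (S K : set C).

Lemma convexC_triangle K p q a c : convexC K -> K 0 -> K p -> K q ->
  0 <= a -> 0 <= c -> a + c <= 1 -> K (a%:C * p + c%:C * q).
Proof.
move=> cK K0 Kp Kq a0 c0 ac; move/convexCP: (cK) => cKP.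
have [ac0|ac0] := eqVneq (a + c) 0.
  have [-> ->] : a = 0 /\ c = 0 by split; lra.
  by rewrite !mul0r addr0.
have acp : 0 < a + c by rewrite lt_neqAle eq_sym ac0 addr_ge0.
(* Normalising the weights gives a point of the segment from [p] to [q], which is then shrunk
   towards 0 by the factor [a + c]. *)
have Kpq : K ((a / (a + c))%:C * p + (1 - a / (a + c))%:C * q).
  apply: cKP => //; rewrite divr_ge0 ?addr_ge0 //=.
  by rewrite ler_pdivrMr // mul1r lerDl.
have := cKP _ _ (a + c) Kpq K0; rewrite mulr0 addr0 ltW // ac => /(_ isT).
rewrite mulrDr !mulrA -!(rmorphM (real_complex R)).
rewrite mulrBr mulr1 (mulrC (a + c)) divfK // (addrC a c).
by rewrite addrK.
Qed.

Lemma cis_decomp t z : z = (dotC (cis t) z)%:C * cis t +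
  (dotC (cis (t + 4^-1)) z)%:C * cis (t + 4^-1) :> C.
Proof.
have [ct st] : cos (2 * pi * (t + 4^-1)) = - sin (2 * pi * t) /\
    sin (2 * pi * (t + 4^-1)) = cos (2 * pi * t).
  rewrite (_ : 2 * pi * _ = 2 * pi * t + pi / 2); last by field.
  by rewrite cosDpihalf sinDpihalf.
case: z => a b; apply/eqP; rewrite eq_complex /dotC /cis ct st /=.
have := cos2Dsin2 (2 * pi * t).
set c := cos _; set s := sin _ => cs.
apply/andP; split; apply/eqP.
  by rewrite -[LHS]mul1r -cs; ring.
by rewrite -[LHS]mul1r -cs; ring.
Qed.

Lemma orthogonal_cis t z : dotC (cis t) z = 0 ->
  z = (dotC (cis (t + 4^-1)) z)%:C * cis (t + 4^-1) :> C.
Proof. by move=> d0; rewrite {1}(cis_decomp t z) d0 mul0r add0r. Qed.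

Definition crossC x y : R :=
  complex.Re x * complex.Im y - complex.Im x * complex.Re y.

Lemma crossC_cis t x : crossC x (cis (t + 4^-1)) = dotC (cis t) x.
Proof.
rewrite /crossC /dotC /cis /= (_ : 2 * pi * (_ + _) = 2 * pi * t + pi / 2).
  by rewrite cosDpihalf sinDpihalf; ring.
by field.
Qed.

Lemma crossC_self x : crossC x x = 0.
Proof. by rewrite /crossC mulrC subrr. Qed.

Lemma crossC_anti x y : crossC x y = - crossC y x.
Proof. by rewrite /crossC; ring. Qed.

Lemma crossCN x y : crossC (- x) y = - crossC x y.
Proof. by case: x y => [a b] [c d]; rewrite /crossC /=; ring. Qed.

Lemma crossC_lin x y a z : crossC x (y + a%:C * z) = crossC x y + a * crossC x z.
Proof. by case: x y z => [b c] [d e] [g h]; rewrite /crossC /=; ring. Qed.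

Lemma cramer x y z :
  (crossC x y)%:C * z = (crossC z y)%:C * x + (crossC x z)%:C * y.
Proof.
case: x y z => [a b] [c d] [g h]; apply/eqP; rewrite eq_complex /crossC /=.
by apply/andP; split; apply/eqP; ring.
Qed.

Lemma face_conv_hull S t : face S t `<=` face (conv_hull S) t.
Proof.
move=> x [Sx xmax]; split; first exact: sub_conv_hull.
move=> y; apply: (conv_hull_sub (@convex_halfplane _ (cis t) (dotC (cis t) x))).
exact: xmax.
Qed.

Lemma face_dotC S t x y : face S t x -> face S t y ->
  dotC (cis t) x = dotC (cis t) y.
Proof. by move=> [Sx xm] [Sy ym]; apply/eqP; rewrite eq_le xm ?ym. Qed.

(** If [S] had at most one point [p] on the supporting line, the open half-plane together with [p]
    would be a convex set containing [S], hence the hull, whose face would then reduce to [p]. *)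
Lemma side_conv_hull S t :
  (exists x y, [/\ face (conv_hull S) t x, face (conv_hull S) t y & x != y]) ->
  exists x y, [/\ face S t x, face S t y & x != y].
Proof.
move=> [x [y [[cx xmax] [cy ymax] xy]]]; apply: contrapT => no.
have xyE : dotC (cis t) y = dotC (cis t) x.
  by apply/eqP; rewrite eq_le xmax ?ymax.
(* When [S] misses the supporting line, any point of that line serves as [p]; [x] is taken. *)
have [p [pE pS]] : exists p, dotC (cis t) p = dotC (cis t) x /\
    forall q, S q -> dotC (cis t) q = dotC (cis t) x -> q = p.
  have [[p [Sp pE]]|noS] := pselect (exists p, S p /\ dotC (cis t) p = dotC (cis t) x).
    exists p; split => // q Sq qE; apply/eqP/negP => /negP qp; apply: no.
    have fS z : S z -> dotC (cis t) z = dotC (cis t) x -> face S t z.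
      by move=> Sz zE; split => // v Sv; rewrite zE xmax //; exact: sub_conv_hull.
    by exists q, p; split => //; exact: fS.
  by exists x; split => // q Sq qE; exfalso; apply: noS; exists q.
pose T := [set z : C | dotC (cis t) z < dotC (cis t) x \/ z = p].
have cT : convexC T.
  apply/convexCP => z v a Tz Tv a01; have := a01; case/andP => a0 a1.
  have [->|a_neq0] := eqVneq a 0.
    by rewrite mul0r add0r subr0 mul1r.
  have [->|a_neq1] := eqVneq a 1.
    by rewrite subrr mul0r addr0 mul1r.
  have ap : 0 < a by rewrite lt_neqAle eq_sym a_neq0.
  have ap1 : 0 < 1 - a by rewrite subr_gt0 lt_neqAle a_neq1.
  case: Tz => [zlt|->]; case: Tv => [vlt|->].
  - left; rewrite dotCD !dotCZ.
    by move: zlt vlt; rewrite -(ltr_pM2l ap) => ?; rewrite -(ltr_pM2l ap1); lra.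
  - by left; rewrite dotCD !dotCZ pE; move: zlt; rewrite -(ltr_pM2l ap); lra.
  - by left; rewrite dotCD !dotCZ pE; move: vlt; rewrite -(ltr_pM2l ap1); lra.
  - right; rewrite -mulrDl -(rmorphD (real_complex R)).
    by rewrite addrC subrK mul1r.
have ST : S `<=` T.
  move=> z Sz; have := xmax z (sub_conv_hull Sz); rewrite le_eqVlt => /orP[/eqP zE|].
    by right; exact: pS.
  by left.
have := conv_hull_sub cT ST cx; have := conv_hull_sub cT ST cy.
rewrite /T /= xyE ltxx => -[//|yp] [//|xp].
by rewrite xp yp eqxx in xy.
Qed.

Lemma side_anglesE S : side_angles (conv_hull S) =
  [set t | 0 <= t < 1 /\ exists x y, [/\ face S t x, face S t y & x != y]].
Proof.
apply/seteqP; split => t [t01 h]; split => //; first exact: side_conv_hull.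
by case: h => x [y [fx fy xy]]; exists x, y; split => //; exact: face_conv_hull.
Qed.

(** Pushing a point of a face outwards by [e / 2] leaves the supporting half-plane, so no ball
    around it lies in the hull. *)
Lemma face_sub_ext S t : face S t `<=` ext S.
Proof.
move=> x [Sx xmax]; split => //; split; first by apply: subset_closure; exact: sub_conv_hull.
move=> /nbhs_normc[e e0 eS].
have e2 : 0 < e / 2 by rewrite divr_gt0.
have /eS : normc (x - (x + (e / 2)%:C * cis t)) < e.
  by rewrite opprD addNKr normc_opp normcZ ?ltW // normc_cis; lra.
move/(conv_hull_sub (@convex_halfplane _ (cis t) (dotC (cis t) x)) xmax).
by rewrite /= dotCD dotCZ dotC_cis subrr mulr0 cos0; lra.
Qed.

Lemma faceDz S t (k : int) : face S (t + k%:~R) = face S t.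
Proof. by rewrite /face cisDz. Qed.

(** Discrete intermediate value theorem. The bound on [j] will keep vertex indices below [2 * b]. *)
Lemma sign_change (g : nat -> R) (m j0 : nat) : (0 < m)%N -> 0 <= g j0 ->
  g (j0 + m)%N <= 0 -> exists2 j, (j < j0 + m)%N & 0 <= g j /\ g j.+1 <= 0.
Proof.
elim: m j0 => // m IH j0 _ g0 gm.
have [g1|g1] := leP (g j0.+1) 0; first by exists j0 => //; lia.
case: m IH gm => [_|m IH]; first by rewrite addn1 leNgt g1.
rewrite addnS -addSn => gm; exact: IH (ltW g1) gm.
Qed.

Lemma finite_pos_lb (N : nat) (g : nat -> R) : (forall j, (j < N)%N -> 0 < g j) ->
  exists2 d, 0 < d & forall j, (j < N)%N -> d <= g j.
Proof.
elim: N => [|N IH] g0; first by exists 1.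
have [|d d0 dg] := IH; first by move=> j jN; apply: g0; exact: leqW.
exists (Num.min d (g N)) => [|j]; first by rewrite lt_min d0 g0.
rewrite ltnS leq_eqVlt => /orP[/eqP ->|/dg jd]; first by rewrite ge_min lexx orbT.
by rewrite ge_min jd.
Qed.

End Convex.

(** * Faces of the attractor *)

Section Faces.
Variables (R : realType) (n : nat) (w lam : (R[i])^o) (r W phi alpha : R).
Local Notation C := (R[i])^o.
Local Notation f := (ifs n lam w).
Hypotheses (n_ge2 : (2 <= n)%N) (r01 : 0 < r < 1) (W_gt0 : 0 < W).
Hypotheses (lamE : lam = r%:C * cis phi) (wE : w = W%:C * cis alpha).

(** * The maps: coefficients, contraction, comparison of graph-directed families *)

Definition coef (k : nat) : R := n%:R - 2 * k%:R - 1.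

Lemma ifsE k z : f k z = lam * z + (coef k)%:C * w.
Proof.
congr (_ + _ * _); rewrite /coef !(rmorphB, rmorphM, rmorph_nat) /=.
by rewrite rmorph1.
Qed.

Lemma coef_rev k : (k < n)%N -> coef (n - k.+1) = - coef k.
Proof. by move=> kn; rewrite /coef natrB // -natr1; ring. Qed.

Lemma ifs_rev k z : (k < n)%N -> f (n - k.+1) (- z) = - f k z.
Proof. by move=> kn; rewrite !ifsE coef_rev // rmorphN /= mulrN mulNr opprD. Qed.

Lemma coef_dist k l : (k < n)%N -> (l < n)%N -> coef k - coef l <= 2 * n.-1%:R.
Proof.
move=> kn ln; rewrite /coef -[leLHS]/(_ - _ - _ - _).
have : l%:R <= n.-1%:R :> R by rewrite ler_nat; lia.
have : 0 <= k%:R :> R by exact: ler0n.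
lra.
Qed.

Let r_ge0 : 0 <= r. Proof. by case/andP: r01 => /ltW. Qed.
Let r_lt1 : r < 1. Proof. by case/andP: r01. Qed.
Let r_gt0 : 0 < r. Proof. by case/andP: r01. Qed.
Let r01' : 0 <= r < 1. Proof. by rewrite r_ge0. Qed.

Lemma normc_lam : normc lam = r.
Proof. by rewrite lamE normcZ // normc_cis mulr1. Qed.

Lemma normc_w : normc w = W.
Proof. by rewrite wE normcZ ?ltW // normc_cis mulr1. Qed.

Lemma lam_neq0 : lam != 0.
Proof.
apply/eqP => l0; have := normc_lam; rewrite l0 /= expr0n /= addr0 sqrtr0.
by move=> r0; move: r_gt0; rewrite -r0 ltxx.
Qed.

Lemma w_neq0 : w != 0.
Proof.
apply/eqP => w0; have := normc_w; rewrite w0 /= expr0n /= addr0 sqrtr0.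
by move=> W0; move: W_gt0; rewrite -W0 ltxx.
Qed.

Lemma ifsB k l x y :
  f k x - f l y = lam * (x - y) + (coef k - coef l)%:C * w.
Proof. rewrite (rmorphB (real_complex R)) !ifsE opprD addrACA -mulrBr.
by rewrite -[X in _ + X]mulrBl. Qed.

Lemma ifsB_same k x y : f k x - f k y = lam * (x - y).
Proof. by rewrite ifsB subrr mul0r addr0. Qed.

Lemma normc_ifsB k x y : normc (f k x - f k y) = r * normc (x - y).
Proof. by rewrite ifsB_same normcM normc_lam. Qed.

Lemma ifs_inj k : injective (f k).
Proof.
by move=> x y /eqP; rewrite -subr_eq0 ifsB_same mulf_eq0 (negPf lam_neq0) /= subr_eq0 => /eqP.
Qed.

Lemma ifs_digit_neq k l x : k != l -> f k x != f l x.
Proof.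
move=> kl; rewrite -subr_eq0 ifsB subrr mulr0 add0r mulf_neq0 ?w_neq0 //.
rewrite eq_complex /= eqxx andbT /coef.
apply: contra kl => /eqP h.
by rewrite -(eqr_nat R); apply/eqP; lra.
Qed.

(** Comparison by contraction: unfold a point of [B i] for [m] steps, then replay the same digits
    from any point of the corresponding [B']. The two results differ by at most [r ^+ m * (D + D)],
    and [B' i] is closed. Central symmetry, inclusions of faces and uniqueness for the system all
    come from this. *)
Lemma graph_directed_sub (I : Type) (next : I -> I) (K : I -> nat -> Prop)
    (B B' : I -> set C) (D : R) :
  (forall i x, B i x -> exists k y, [/\ K i k, B (next i) y & x = f k y]) ->
  (forall i k y, K i k -> B' (next i) y -> B' i (f k y)) ->
  (forall i, B' i !=set0) -> (forall i, closed (B' i)) ->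
  (forall i x, B i x \/ B' i x -> normc x <= D) ->
  forall i, B i `<=` B' i.
Proof.
move=> Bdec B'comp B'0 B'cl bnd i x Bx.
have approx (m : nat) : forall j z, B j z ->
    exists2 y, B' j y & normc (z - y) <= r ^+ m * (D + D).
  elim: m => [|m IH] j z Bz.
    have [y By] := B'0 j; exists y => //; rewrite expr0 mul1r.
    apply: le_trans (normc_triangle _ _) _; rewrite normc_opp.
    by apply: lerD; apply: (bnd j); [left|right].
  have [k [z' [Kk Bz' ->]]] := Bdec _ _ Bz.
  have [y By zy] := IH _ _ Bz'.
  exists (f k y); first exact: B'comp.
  by rewrite normc_ifsB exprS -mulrA ler_wpM2l.
apply: closed_approx (B'cl i) _ => e e0.
have [m me] := geom_lt (D + D) r01' e0.
by have [y By xy] := approx m _ _ Bx; exists y => //; apply: le_lt_trans me.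
Qed.

Lemma dotC_ifs t k z : dotC (cis t) (f k z) =
  r * dotC (cis (t - phi)) z + coef k * (W * cos (2 * pi * (t - alpha))).
Proof.
rewrite ifsE dotCD dotCZ wE dotCZ dotC_cis lamE.
by congr (_ + _); rewrite -mulrA dotCZ dotC_rot.
Qed.

(** The digits maximizing [coef k * a]: since [coef] decreases, a positive [a] forces the first
    digit, a negative one the last, and [a = 0] leaves all of them free. *)
Definition optimal (a : R) (k : nat) : Prop :=
  [/\ (k < n)%N, 0 < a -> k = 0%N & a < 0 -> k = n.-1].

Lemma optimal_ex a : exists k, optimal a k.
Proof.
have n0 : (n.-1 < n)%N by rewrite prednK // (leq_trans _ n_ge2).
have [a0|a0] := ltP a 0; [exists n.-1|exists 0%N]; split => //.
- by move=> /(lt_trans a0); rewrite ltxx.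
- by rewrite (leq_trans _ n_ge2).
- by rewrite ltNge a0.
Qed.

Lemma optimal_max a k l : optimal a k -> (l < n)%N -> coef l * a <= coef k * a.
Proof.
case=> kn kp kn' ln; have [a0|a0|->] := ltrgtP a 0; last by rewrite !mulr0.
- rewrite kn' // ler_nM2r // /coef.
  have : l%:R <= n.-1%:R :> R by rewrite ler_nat; lia.
  lra.
- rewrite kp // ler_pM2r // /coef.
  have : 0 <= l%:R :> R by exact: ler0n.
  lra.
Qed.

Lemma max_optimal a k : (k < n)%N ->
  (forall l, (l < n)%N -> coef l * a <= coef k * a) -> optimal a k.
Proof.
move=> kn kmax; split => // a0.
- have /kmax : (0 < n)%N by lia.
  rewrite ler_pM2r // /coef => h.
  have : (k%:R : R) <= 0%:R by lra.
  by rewrite ler_nat; lia.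
- have /kmax : (n.-1 < n)%N by lia.
  rewrite ler_nM2r // /coef => h.
  have : (n.-1%:R : R) <= k%:R by lra.
  by rewrite ler_nat; lia.
Qed.

Lemma optimalZ c a k : 0 < c -> optimal (c * a) k <-> optimal a k.
Proof.
by move=> c0; split => -[kn k1 k2]; split => // a0;
  [apply: k1|apply: k2|apply: k1|apply: k2]; move: a0; rewrite ?pmulr_rgt0 ?pmulr_rlt0.
Qed.

Lemma optimal_eq0 a k : (k < n)%N -> a = 0 -> optimal a k.
Proof. by move=> kn ->; split => //; rewrite ltxx. Qed.

Lemma optimal_uniq a k l : a != 0 -> optimal a k -> optimal a l -> k = l.
Proof.
move=> a0 [_ k1 k2] [_ l1 l2].
have [h|h|h] := ltrgtP a 0; first by rewrite k2 ?l2.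
- by rewrite k1 ?l1.
- by rewrite h eqxx in a0.
Qed.

(** * Central symmetry of the attractor and recursion for its faces *)

Variable A : set C.
Hypothesis attA : is_attractor n f A.

Let A_neq0 : A !=set0. Proof. by case: attA. Qed.
Let A_compact : compact A. Proof. by case: attA. Qed.
Let A_ex x : A x -> exists k y, [/\ (k < n)%N, A y & x = f k y].
Proof.
by case: attA => _ _ {1}-> [k kn [y Ay <-]]; exists k, y.
Qed.
Let A_ifs k y : (k < n)%N -> A y -> A (f k y).
Proof. by case: attA => _ _ AE kn Ay; rewrite AE; exists k => //; exists y. Qed.

Let A_closed : closed A.
Proof. exact: compact_closed (@complex_hausdorff R) A_compact. Qed.

(** Reversing the digits shows that [- A] decomposes by the same maps as [A], so the comparison
    principle puts it inside [A]. *)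
Lemma attractor_opp x : A x -> A (- x).
Proof.
have [D _ AD] := compact_normc_bounded A_compact.
suff /(_ tt (- x)) : forall i : unit, [set - y | y in A] `<=` A.
  by move=> h Ax; apply: h; exists x.
apply: (@graph_directed_sub unit (fun=> tt) (fun _ k => (k < n)%N)
          (fun=> [set - y | y in A]) (fun=> A) D) => //.
- move=> _ _ [y /A_ex[k [z [kn Az ->]]] <-].
  exists (n - k.+1)%N, (- z); split; [lia|by exists z|].
  by symmetry; exact: ifs_rev.
- by move=> _ y [[z Az <-]|Ay]; rewrite ?normc_opp; exact: AD.
Qed.

Lemma face_neq0 t : face A t !=set0.
Proof.
have [c cA cP] := compact_EVT_max A_neq0 A_compact
  (continuous_subspaceT (@dotC_continuous R t)).
by exists c; split => [|y Ay]; [exact: set_mem|apply/cP/mem_set].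
Qed.

Lemma face_closed t : closed (face A t).
Proof.
move=> x xcl; have Ax : A x.
  by apply: A_closed => V /xcl[y [[Ay _] Vy]]; exists y.
split => // y Ay.
have ccl : closed ([set z : C | dotC (cis t) y <= dotC (cis t) z]).
  apply: (@closed_comp _ _ (dotC (cis t)) [set v : R | dotC (cis t) y <= v]).
    by move=> ? _; exact: dotC_continuous.
  exact: closed_ge.
by apply: ccl => V /xcl[z [[Az zmax] Vz]]; exists z; split => //; exact: zmax.
Qed.

Lemma face_sub_attractor t : face A t `<=` A. Proof. by move=> x []. Qed.

Lemma face_compact t : compact (face A t).
Proof. exact: subclosed_compact (@face_closed t) A_compact (@face_sub_attractor t). Qed.

Let digit_cos t := cos (2 * pi * (t - alpha)).

Lemma face_ifs t k y : optimal (digit_cos t) k -> face A (t - phi) y ->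
  face A t (f k y).
Proof.
move=> ok [Ay ymax]; split; first by apply: A_ifs => //; case: ok.
move=> _ /A_ex[l [z [ln Az ->]]]; rewrite !dotC_ifs.
apply: lerD; first by rewrite ler_wpM2l // ymax.
by apply: optimal_max => //; apply/optimalZ.
Qed.

(** The functional splits into a digit part and a point part: varying the digit with [y] fixed, then
    the point with [k] fixed, shows that each part is maximal. *)
Lemma face_ifs_inv t k y : (k < n)%N -> A y -> face A t (f k y) ->
  optimal (digit_cos t) k /\ face A (t - phi) y.
Proof.
move=> kn Ay [_ fmax]; split.
  apply/(optimalZ _ _ W_gt0)/max_optimal => // l ln.
  by have := fmax _ (A_ifs ln Ay); rewrite !dotC_ifs lerD2l.
split => // z Az.
by have := fmax _ (A_ifs kn Az); rewrite !dotC_ifs lerD2r ler_pM2l.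
Qed.

Lemma face_ex t x : face A t x ->
  exists k y, [/\ optimal (digit_cos t) k, face A (t - phi) y & x = f k y].
Proof.
move=> fx; have [k [y [kn Ay xE]]] := A_ex (face_sub_attractor fx).
move: fx; rewrite xE => /(face_ifs_inv kn Ay) [ok fy].
by exists k, y.
Qed.

(** A face is determined by the digits that are optimal along the backward orbit of its direction,
    so the comparison principle applies with the number of steps as index. *)
Lemma face_sub t t' :
  (forall (j : nat) k, optimal (digit_cos (t - j%:R * phi)) k ->
     optimal (digit_cos (t' - j%:R * phi)) k) ->
  face A t `<=` face A t'.
Proof.
move=> sub.
have [D _ AD] := compact_normc_bounded A_compact.
have stepE (u : R) (j : nat) : u - j.+1%:R * phi = u - j%:R * phi - phi.
  by rewrite -natr1; ring.
suff /(_ 0%N) : forall j : nat,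
    face A (t - j%:R * phi) `<=` face A (t' - j%:R * phi).
  by rewrite mul0r !subr0.
apply: (@graph_directed_sub nat succn
  (fun j => optimal (digit_cos (t - j%:R * phi))) _ _ D).
- move=> j x /face_ex[k [y [ok fy ->]]].
  by exists k, y; split => //; rewrite stepE.
- move=> j k y /sub ok fy; apply: face_ifs => //.
  by rewrite -stepE.
- by move=> j; exact: face_neq0.
- by move=> j; exact: face_closed.
- by move=> j x [] /face_sub_attractor /AD.
Qed.

(** Each non-zero cosine leaves a single optimal digit, so both points begin with the same [m]
    digits and their difference is scaled [m] times. *)
Lemma face_forced (m : nat) t x y :
  (forall j, (j < m)%N -> digit_cos (t - j%:R * phi) != 0) ->
  face A t x -> face A t y ->
  exists x' y', [/\ face A (t - m%:R * phi) x', face A (t - m%:R * phi) y'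
    & normc (x - y) = r ^+ m * normc (x' - y')].
Proof.
elim: m t x y => [|m IH] t x y nz fx fy.
  by exists x, y; rewrite mul0r subr0 expr0 mul1r.
have [k [x1 [ok fx1 ->]]] := face_ex fx.
have [l [y1 [ol fy1 ->]]] := face_ex fy.
have d0 : digit_cos t != 0 by have := nz 0%N isT; rewrite mul0r subr0.
rewrite -(optimal_uniq d0 ok ol) normc_ifsB.
have stepE (j : nat) : t - phi - j%:R * phi = t - j.+1%:R * phi.
  by rewrite -natr1; ring.
have [|x' [y' [fx' fy' E]]] := IH (t - phi) x1 y1 _ fx1 fy1.
  by move=> j jm; rewrite stepE; exact: nz.
by exists x', y'; rewrite -stepE; split => //; rewrite E exprS mulrA.
Qed.

Lemma face_singleton t x y :
  (forall j : nat, digit_cos (t - j%:R * phi) != 0) ->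
  face A t x -> face A t y -> x = y.
Proof.
move=> nz fx fy; apply/eqP; rewrite -subr_eq0; apply/eqP/eq0_normc/eqP.
have [D _ AD] := compact_normc_bounded A_compact.
rewrite eq_le normc_ge0 andbT; apply: (le_geom (D := D + D) r01') => m.
have [x' [y' [/face_sub_attractor /AD x'D /face_sub_attractor /AD y'D ->]]] :=
  @face_forced m _ _ _ (fun j _ => nz j) fx fy.
rewrite add0r ler_wpM2l ?exprn_ge0 //.
by apply: le_trans (normc_triangle _ _) _; rewrite normc_opp; exact: lerD.
Qed.

(** Where the cosine vanishes, digits 0 and 1 are both optimal and give distinct points; the
    injective maps carry such a pair through the [j] preceding steps. *)
Lemma face_two_points t (j : nat) : digit_cos (t - j%:R * phi) = 0 ->
  exists x y, [/\ face A t x, face A t y & x != y].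
Proof.
elim: j t => [|j IH] t.
  rewrite mul0r subr0 => d0; have [y fy] := face_neq0 (t - phi).
  exists (f 0 y), (f 1 y); split; last exact: ifs_digit_neq.
  - by apply: face_ifs => //; apply: optimal_eq0 => //; lia.
  - by apply: face_ifs => //; apply: optimal_eq0 => //; lia.
rewrite (_ : t - _ = t - phi - j%:R * phi); last by rewrite -natr1; ring.
move=> /IH[x [y [fx fy xy]]].
have [k ok] := optimal_ex (digit_cos t).
exists (f k x), (f k y); split; try exact: face_ifs.
by apply: contra xy => /eqP /ifs_inj ->.
Qed.

(* Let [y1] and [y2] be extreme on [face A (t - phi)] in the direction of
   [w / lam].  The middle of [f 0 y1] and [f 1 y2] lies on [face A t], hence in
   some [f k] of [face A (t - phi)]; comparing the components along [w] shows
   that [y1] and [y2] are far apart. *)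
Lemma convex_gap : convexC A -> exists x y,
  [/\ face A (alpha + 4^-1 - phi) x, face A (alpha + 4^-1 - phi) y
    & 2 * W <= r * normc (x - y)].
Proof.
move=> /convexCP cA; set t := alpha + 4^-1.
have d0 : digit_cos t = 0.
  by rewrite /digit_cos (_ : t - alpha = 4^-1) ?cos2pi_quarter // /t; ring.
pose l := dotC (cis (alpha - phi)) : C -> R.
have lf k z : dotC (cis alpha) (f k z) = r * l z + coef k * W.
  by rewrite dotC_ifs subrr mulr0 cos0 mulr1.
have cl := continuous_subspaceT (@dotC_continuous R (alpha - phi)).
have [y1 /set_mem f1 y1max] := compact_EVT_max (face_neq0 (t - phi))
  (@face_compact (t - phi)) (cl _).
have [y2 /set_mem f2 y2min] := compact_EVT_min (face_neq0 (t - phi))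
  (@face_compact (t - phi)) (cl _).
have n0 : (0 < n)%N by apply: leq_trans n_ge2.
have F1 : face A t (f 0 y1) by apply: face_ifs => //; exact: optimal_eq0.
have F2 : face A t (f 1 y2) by apply: face_ifs => //; exact: optimal_eq0.
pose M : C := (2^-1)%:C * f 0 y1 + (1 - 2^-1)%:C * f 1 y2.
have FM : face A t M.
  split; first by apply: cA; [case: F1|case: F2|apply/andP; split; lra].
  move=> z Az; rewrite dotCD !dotCZ.
  by case: F1 => _ /(_ z Az); case: F2 => _ /(_ z Az); lra.
have [k [y [_ fy ME]]] := face_ex FM.
have := congr1 (dotC (cis alpha)) ME.
rewrite dotCD !dotCZ !lf /coef => E.
have := y1max _ (mem_set fy); have := y2min _ (mem_set fy).
rewrite -/(l _) -/(l _) -/(l _) => ly2 ly1.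
exists y1, y2; split => //.
have lN : l y1 - l y2 <= normc (y1 - y2) by rewrite -dotCB dotC_normc_le.
apply: le_trans (ler_wpM2l r_ge0 lN).
have rl1 : r * l y <= r * l y1 by rewrite ler_wpM2l.
have rl2 : r * l y2 <= r * l y by rewrite ler_wpM2l.
(* For [k = 0] the bound comes from minimality at [y2], for positive [k] from maximality at [y1]. *)
rewrite mulrBr; case: k ME E => [|k] ME E; first by lra.
have : 0 <= k%:R * W by rewrite mulr_ge0 // ltW.
have k1 : k.+1%:R = k%:R + 1 :> R by rewrite -natr1.
by move: E; rewrite k1; lra.
Qed.

(** * Itineraries *)

Lemma cvg_normcP (u : nat -> C) x : u @ \oo --> x <->
  forall e, 0 < e -> exists N, forall k, (N <= k)%N -> normc (x - u k) < e.
Proof.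
split=> [ux e e0|ux V /nbhs_normc[e e0 eV]].
  have /ux[N _ NP] : nbhs x [set y | normc (x - y) < e] by apply/nbhs_normc; exists e.
  by exists N => k Nk; exact: NP.
by have [N NP] := ux e e0; exists N => // k /= Nk; apply: eV; exact: NP.
Qed.

Local Notation prefix s k z := (foldr (fun i : 'I_n => f i) z (mkseq s k)).

Lemma prefix_rec (s : nat -> 'I_n) k z :
  prefix s k.+1 z = f (s 0%N) (prefix (s \o succn) k z).
Proof.
rewrite /mkseq /=; congr (f _ (foldr _ _ _)).
by rewrite -[iota 1 k]/(iota (1 + 0) k) iotaDl -map_comp.
Qed.

Lemma prefix_last (s : nat -> 'I_n) k z : prefix s k.+1 z = prefix s k (f (s k) z).
Proof. by rewrite mkseqS foldr_rcons. Qed.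

Lemma normc_prefixB (s : nat -> 'I_n) k x y :
  normc (prefix s k x - prefix s k y) = r ^+ k * normc (x - y).
Proof.
elim: k x y => [|k IH] x y; first by rewrite mul1r.
by rewrite !prefix_last IH normc_ifsB exprSr mulrA.
Qed.

Lemma prefix_attractor (s : nat -> 'I_n) k x : A x -> A (prefix s k x).
Proof.
by elim: k x => // k IH x Ax; rewrite prefix_last; apply/IH/A_ifs.
Qed.

Lemma itinerary_attractor (s : nat -> 'I_n) x : is_itinerary f s x -> A x.
Proof.
move=> sx; have [y Ay] := A_neq0.
apply: closed_approx A_closed _ => e e0.
have /cvg_normcP/(_ e e0)[N NP] := sx y.
by exists (prefix s N.+1 y); [exact: prefix_attractor|exact: NP].
Qed.

Lemma itinerary_shift (s : nat -> 'I_n) x : is_itinerary f s x ->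
  exists2 y, x = f (s 0%N) y & is_itinerary f (s \o succn) y.
Proof.
move=> sx; have [y xE] : exists y, x = f (s 0%N) y.
  exists (lam^-1 * (x - (coef (s 0%N))%:C * w)).
  by rewrite ifsE mulVKf ?lam_neq0 // subrK.
exists y; first exact: xE.
move=> z; apply/cvg_normcP => e e0.
have /cvg_normcP/(_ (r * e))[|N NP] := sx z; first by rewrite mulr_gt0.
exists N => k Nk; have := NP k.+1 (leqW Nk).
by rewrite prefix_rec xE normc_ifsB ltr_pM2l.
Qed.

(** Applying the first [k] maps to a point of [P k] lands in the compact set [P 0]. A cluster point
    of these images stays within a geometric distance of every prefix, hence is the limit. *)
Lemma itinerary_ex (s : nat -> 'I_n) (P : nat -> set C) :
  (forall j, P j !=set0) -> (forall j, P j `<=` A) -> compact (P 0%N) ->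
  (forall j x, P j.+1 x -> P j (f (s j) x)) ->
  exists2 x, P 0%N x & is_itinerary f s x.
Proof.
move=> P0 PA cP Ps.
have /choice[z zP] j : exists z, P j z by have [z] := P0 j; exists z.
have down k d y : P (k + d)%N y -> exists2 y', P k y' & prefix s (k + d) y = prefix s k y'.
  elim: d y => [|d IH] y; first by rewrite addn0; exists y.
  rewrite addnS => /Ps /IH[y' Py' yE].
  by exists y' => //; rewrite prefix_last.
pose u k := prefix s k (z k).
have uP k : P 0%N (u k) by have [y Py yE] := down 0%N k _ (zP k); rewrite /u yE.
have uF : (u @ \oo) (P 0%N) by exists 0%N => // k _; exact: uP.
have [x [Px xcl]] := cP (u @ \oo) _ uF.
exists x => // v; apply/cvg_normcP => e e0.
have [D _ AD] := compact_normc_bounded A_compact.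
have bound k : normc (x - prefix s k v) <= r ^+ k * (D + normc v).
  apply/ler_addgt0Pr => d d0.
  (* Some [u m] with [m >= k] is within [d] of [x]; being built on the same first [k] digits, it is
     close to the prefix of length [k]. *)
  have [||_ [[m km <-] xu]] := xcl (u @` [set m | (k <= m)%N]) [set y | normc (x - y) < d].
  - by exists k => // m km; exists m.
  - by apply/nbhs_normc; exists d.
  have [|y Py] := down k (m - k)%N (z m); first by rewrite subnKC.
  rewrite subnKC // => yE.
  have -> : x - prefix s k v = x - u m + (prefix s k y - prefix s k v).
    by rewrite /u yE addrA subrK.
  apply: le_trans (normc_triangle _ _) _; rewrite addrC; apply: lerD; last exact: ltW xu.
  rewrite normc_prefixB ler_wpM2l ?exprn_ge0 //.
  apply: le_trans (normc_triangle _ _) _; rewrite normc_opp lerD2r.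
  exact/AD/PA/Py.
have [N Ne] := geom_lt (D + normc v) r01' e0.
exists N => k Nk; apply: le_lt_trans (bound k.+1) (le_lt_trans _ Ne).
have Dv : 0 <= D + normc v.
  by rewrite addr_ge0 ?normc_ge0 // (le_trans _ (AD _ (PA _ _ (zP 0%N)))) ?normc_ge0.
by rewrite ler_wpM2r // ler_wiXn2l ?r_ge0 ?(ltW r_lt1) // leqW.
Qed.

(** * Rational angle *)

Section Grid.
Variables (b : nat) (c : int).
Hypotheses (b_gt0 : (0 < b)%N) (cop : coprimez b c).
Hypothesis phiE : phi = c%:~R / (2 * b%:R).

(** Directions in steps of [1 / (2 * b)] turn, starting from the normal [alpha + 1/4] to [w].
    Turning back by [phi] subtracts [c]; half-integers are the directions midway between grid
    angles. *)
Definition grid (x : R) : R := alpha + 4^-1 + x / (2 * b%:R).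

Let b0 : 0 < b%:R :> R. Proof. by rewrite ltr0n. Qed.
Let b_ge1 : 1 <= b%:R :> R. Proof. by rewrite ler1n. Qed.
Let bN0 : b%:R != 0 :> R. Proof. by rewrite gt_eqF. Qed.

Lemma grid_sub x m : grid x - m * phi = grid (x - m * c%:~R).
Proof. by rewrite /grid phiE; field. Qed.

Lemma gridDb x : grid (x + b%:R) = grid x + 2^-1.
Proof. by rewrite /grid; field. Qed.

Lemma face_gridDz x (k : int) : face A (grid (x + k%:~R * (2 * b%:R))) = face A (grid x).
Proof.
by rewrite -(faceDz A (grid x) k); congr (face A _); rewrite /grid; field.
Qed.

Lemma digit_cos_grid x : digit_cos (grid x) = cos (2 * pi * (4^-1 + x / (2 * b%:R))).
Proof. by congr (cos (_ * _)); rewrite /grid; ring. Qed.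

Lemma digit_cos_gridDb x (k : int) :
  digit_cos (grid (x + k%:~R * b%:R)) = (-1) ^ k * digit_cos (grid x).
Proof.
by rewrite !digit_cos_grid -cos2pi_half_add; congr (cos (_ * _)); field.
Qed.

Lemma digit_cos_grid_lt0 x : 0 < x < b%:R -> digit_cos (grid x) < 0.
Proof.
move=> /andP[x0 xb]; rewrite digit_cos_grid; apply: cos2pi_lt0.
  by rewrite ltrDl divr_gt0 // mulr_gt0.
have : x / (2 * b%:R) < 2^-1 by rewrite ltr_pdivrMr ?mulr_gt0 // mulKf.
lra.
Qed.

Lemma digit_cos_grid_eq0 (z : int) : (digit_cos (grid z%:~R) == 0) = (b %| z)%Z.
Proof.
apply/eqP/dvdzP => [|[k ->]].
  rewrite digit_cos_grid => /cos2pi_eq0[k kE]; exists k.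
  have : z%:~R = (k * b)%:~R :> R.
    rewrite rmorphM /=.
    have {}kE : z%:~R / (2 * b%:R) = k%:~R / 2 :> R by lra.
    by rewrite -[LHS](divfK (_ : 2 * b%:R != 0)) ?mulf_neq0 // kE; field.
  by move/intr_inj.
rewrite rmorphM /= -[X in grid X]add0r digit_cos_gridDb digit_cos_grid.
by rewrite mul0r addr0 cos2pi_quarter mulr0.
Qed.

Lemma digit_cos_grid0 : digit_cos (grid 0) = 0.
Proof. by apply/eqP; rewrite (digit_cos_grid_eq0 0) dvdz0. Qed.

Lemma digit_cos_gridb : digit_cos (grid b%:R) = 0.
Proof. by apply/eqP; rewrite (digit_cos_grid_eq0 b) dvdzz. Qed.

(* Between two consecutive grid angles the cosine keeps a constant sign, so
   the optimal digits there are optimal at both ends. *)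
Lemma optimal_mid (z : int) k : digit_cos (grid (z%:~R + 2^-1)) != 0 /\
  (optimal (digit_cos (grid (z%:~R + 2^-1))) k ->
   optimal (digit_cos (grid z%:~R)) k /\ optimal (digit_cos (grid (z%:~R + 1))) k).
Proof.
(* A shift by [b] is a half turn and flips the sign, so [z] may be reduced modulo [b]; strictly
   between 0 and [b] the cosine is negative. *)
pose q := (z %/ b)%Z; pose s : R := (-1) ^ q.
have zE : z = (z %/ b)%Z * b + (z %% b)%Z by exact: divz_eq.
have m0 : 0 <= ((z %% b)%Z)%:~R :> R.
  by rewrite ler0z modz_ge0 // eqz_nat; lia.
have mb : ((z %% b)%Z)%:~R + 1 <= b%:R :> R.
  rewrite -[1]/(1%:~R) -rmorphD /= -[leRHS]/((b%:Z)%:~R) ler_int.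
  have : (z %% b)%Z < b by rewrite ltz_pmod.
  lia.
have gE d : digit_cos (grid (z%:~R + d)) =
    s * digit_cos (grid (((z %% b)%Z)%:~R + d)).
  rewrite /s -digit_cos_gridDb; congr (digit_cos (grid _)).
  by rewrite {1}zE rmorphD rmorphM /=; ring.
have le0 x : 0 <= x <= b%:R -> digit_cos (grid x) <= 0.
  move=> /andP[]; rewrite le_eqVlt => /orP[/eqP <- _|x0].
    by rewrite digit_cos_grid0.
  rewrite le_eqVlt => /orP[/eqP ->|xb]; first by rewrite digit_cos_gridb.
  by apply/ltW/digit_cos_grid_lt0; rewrite x0.
have s0 : s != 0 by rewrite expfz_eq0 oppr_eq0 oner_eq0 andbF.
rewrite -[X in digit_cos (grid X%:~R)]addr0 rmorphD /= !gE.
set a := digit_cos _; set a0 := digit_cos _; set a1 := digit_cos _.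
have aN : a < 0 by apply: digit_cos_grid_lt0; apply/andP; split; lra.
have a0N : a0 <= 0 by apply: le0; apply/andP; split; lra.
have a1N : a1 <= 0 by apply: le0; apply/andP; split; lra.
split; first by rewrite mulf_neq0 // lt_eqF.
have [sp|sn|s00] := ltrgtP s 0; last by rewrite s00 eqxx in s0.
- case=> kn k1 _; split; split => //; rewrite ?nmulr_rlt0 ?nmulr_rgt0 // => h.
  + by apply: k1; rewrite nmulr_rgt0.
  + by move: (lt_le_trans h a0N); rewrite ltxx.
  + by apply: k1; rewrite nmulr_rgt0.
  + by move: (lt_le_trans h a1N); rewrite ltxx.
- case=> kn _ k1; split; split => //; rewrite ?pmulr_rlt0 ?pmulr_rgt0 // => h.
  + by move: (lt_le_trans h a0N); rewrite ltxx.
  + by apply: k1; rewrite pmulr_rlt0.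
  + by move: (lt_le_trans h a1N); rewrite ltxx.
  + by apply: k1; rewrite pmulr_rlt0.
Qed.

Let shiftE (j : int) (m : nat) : j%:~R - m%:R * c%:~R = (j - m%:Z * c)%:~R :> R.
Proof. by rewrite rmorphB rmorphM. Qed.

(** Subtracting multiples of [phi] sends mid-directions to mid-directions, so the comparison of
    optimal digits holds along the whole orbit. *)
Lemma face_mid_sub (z : int) : face A (grid (z%:~R + 2^-1)) `<=`
  face A (grid z%:~R) `&` face A (grid (z%:~R + 1)).
Proof.
rewrite subsetI; split; apply: face_sub => m k; rewrite !grid_sub.
- by rewrite addrAC shiftE => /(optimal_mid _ k).2[].
- by rewrite addrAC (addrAC _ 1) shiftE => /(optimal_mid _ k).2[].
Qed.

Lemma face_mid_singleton (z : int) x y : face A (grid (z%:~R + 2^-1)) x ->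
  face A (grid (z%:~R + 2^-1)) y -> x = y.
Proof.
apply: face_singleton => m.
by rewrite grid_sub addrAC shiftE; exact: (optimal_mid _ 0).1.
Qed.

(** * Vertices and edges of the convex hull *)

Lemma face_half t x : face A (t + 2^-1) x <-> face A t (- x).
Proof.
rewrite /face cisDhalf.
have dN u z : dotC (- u) z = dotC u (- z).
  by case: u z => [d e] [g h]; rewrite /dotC /=; ring.
split=> -[/attractor_opp Ax xmax]; split => //.
- move=> y /attractor_opp Ay; rewrite -dN -[leLHS]/(dotC _ y).
  by have := xmax _ Ay; rewrite dN opprK.
- by rewrite -[x]opprK.
- by move=> y /attractor_opp Ay; rewrite !dN; exact: xmax.
Qed.

(** This face is non-empty and reduced to one point, so the choice is determined and the default 0
    is never reached by default. *)
Definition vertex (j : nat) : C := xget 0 (face A (grid (j%:R + 2^-1))).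

Lemma vertexP j : face A (grid (j%:R + 2^-1)) (vertex j).
Proof. by case: (face_neq0 (grid (j%:R + 2^-1))) => x fx; exact: xgetI fx. Qed.

Lemma vertex_attractor j : A (vertex j).
Proof. by case: (vertexP j). Qed.

Lemma vertex_face j : face A (grid j%:R) (vertex j).
Proof. by case: (face_mid_sub (z := j) (vertexP j)). Qed.

Lemma vertex_faceS j : face A (grid (j%:R + 1)) (vertex j).
Proof. by case: (face_mid_sub (z := j) (vertexP j)). Qed.

Lemma vertexDb j : vertex (j + b) = - vertex j.
Proof.
rewrite -[LHS]opprK; congr (- _); apply: (@face_mid_singleton j); last exact: vertexP.
apply/face_half; rewrite -gridDb.
by have := vertexP (j + b); rewrite natrD addrAC.
Qed.

Lemma vertexb : vertex b = - vertex 0.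
Proof. by rewrite -vertexDb add0n. Qed.

Lemma grid_side (z : int) :
  exists x y, [/\ face A (grid z%:~R) x, face A (grid z%:~R) y & x != y].
Proof.
have [u [v uvE]] : exists u v : int, u * b + v * c = 1.
  by have [u [v uv]] := Bezoutz b c; exists u, v; rewrite uv; exact/eqP.
have bz : (b%:Z) != 0 by rewrite eqz_nat; lia.
(* [v] inverts [c] modulo [b], so [z - m * c] is a multiple of [b]: after [m] steps the cosine
   vanishes. *)
pose m := `|((z * v) %% b)%Z|%N.
have mE : m%:Z = ((z * v) %% b)%Z by rewrite /m gez0_abs // modz_ge0.
apply: (@face_two_points _ m); apply/eqP.
rewrite grid_sub shiftE digit_cos_grid_eq0 mE.
apply/dvdzP; exists (z * u + ((z * v) %/ b)%Z * c).
have vE := divz_eq (z * v) b.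
have -> : ((z * v) %% b)%Z = z * v - ((z * v) %/ b)%Z * b by rewrite {2}vE; ring.
apply/eqP; rewrite -subr_eq0; set lhs := (X in X == 0).
have -> : lhs = z * (1 - (u * b + v * c)) by rewrite /lhs; ring.
by rewrite uvE subrr mulr0.
Qed.

(** Both vertices lie on the side with normal [grid (j + 1)]. The mid-directions on either side of
    this normal have products of opposite signs with the edge direction, which orients the edge. *)
Lemma vertex_edge j : exists2 L : R, 0 < L &
  vertex j.+1 = vertex j + L%:C * cis (grid (j%:R + 1) + 4^-1).
Proof.
set t := grid (j%:R + 1).
have fv : face A t (vertex j) by exact: vertex_faceS.
have fv' : face A t (vertex j.+1) by have := vertex_face j.+1; rewrite -natr1.
have perp x : face A t x -> exists L, x = vertex j + L%:C * cis (t + 4^-1).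
  move=> fx; exists (dotC (cis (t + 4^-1)) (x - vertex j)).
  have d0 : dotC (cis t) (x - vertex j) = 0 by rewrite dotCB (face_dotC fx fv) subrr.
  by rewrite -(orthogonal_cis d0) addrC subrK.
(* Half a grid step, the angle between the normal [t] and either neighbouring mid-direction. *)
have b41 : (0 : R) < (4 * b%:R)^-1 by rewrite invr_gt0 mulr_gt0.
have b42 : (4 * b%:R)^-1 <= (4^-1 : R).
  by rewrite lef_pV2 ?posrE ?mulr_gt0 // ler_peMr.
have cp : 0 < cos (2 * pi * (grid (j.+1%:R + 2^-1) - (t + 4^-1))).
  apply: cos2pi_gt0; rewrite (_ : _ - _ = (4 * b%:R)^-1 - 4^-1); try lra;
    by rewrite /t /grid -natr1; field.
have cn : cos (2 * pi * (grid (j%:R + 2^-1) - (t + 4^-1))) < 0.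
  rewrite -cosN (_ : - _ = 2 * pi * (4^-1 + (4 * b%:R)^-1)); last first.
    by rewrite /t /grid; field.
  by apply: cos2pi_lt0; lra.
have [L vE] := perp _ fv'.
exists L => //; rewrite lt_neqAle; apply/andP; split; last first.
  have [_ /(_ _ (vertex_attractor j))] := vertexP j.+1.
  by rewrite vE dotCD lerDl dotCZ dotC_cis pmulr_lge0.
(* If the two vertices coincided, the two mid-directions would confine the whole side to one point,
   contradicting [grid_side]. *)
apply/negP => /eqP L0.
have vv : vertex j.+1 = vertex j by rewrite vE -L0 mul0r addr0.
have [x [y [fx fy]]] := grid_side j.+1; move: fx fy.
rewrite -[j.+1%:~R]/(j.+1%:R) -natr1 -/t => fx fy.
suff E z : face A t z -> z = vertex j by rewrite (E _ fx) (E _ fy) eqxx.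
move=> fz; have [M zE] := perp _ fz.
have [_ /(_ _ (face_sub_attractor fz))] := vertexP j.+1.
rewrite vv {1}zE dotCD gerDl dotCZ dotC_cis pmulr_lle0 // => M0.
have [_ /(_ _ (face_sub_attractor fz))] := vertexP j.
rewrite {1}zE dotCD gerDl dotCZ dotC_cis nmulr_lle0 // => M1.
have M00 : M = 0 by apply/eqP; rewrite eq_le M0 M1.
by rewrite zE M00 mul0r addr0.
Qed.

Lemma attractor_halfplane x j : A x ->
  dotC (cis (grid (j%:R + 1))) x <= dotC (cis (grid (j%:R + 1))) (vertex j).
Proof. by move=> Ax; case: (vertex_faceS j) => _; exact. Qed.

(** If all of [A] is maximal in direction [t], then digits 0 and 1 are both optimal, which forces
    the cosine to vanish. *)
Lemma digit_cos_flat t : A `<=` face A t -> digit_cos t = 0 /\ A `<=` face A (t - phi).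
Proof.
move=> At; have E k y : (k < n)%N -> A y -> optimal (digit_cos t) k /\ face A (t - phi) y.
  by move=> kn Ay; apply: face_ifs_inv => //; exact/At/A_ifs.
split; last by move=> y Ay; case: (E 0%N y) => //; lia.
have [y Ay] := A_neq0.
apply/eqP/negP => /negP d0.
have [|o0 _] := E 0%N y _ Ay; first by lia.
have [|o1 _] := E 1%N y _ Ay; first by lia.
by have := optimal_uniq d0 o0 o1.
Qed.

(** By central symmetry a zero height makes [A] flat. Flatness at this angle and one step back gives
    that [b] divides [j + 1] and [j + 1 - c], hence [c], against coprimality. *)
Lemma halfplane_height_gt0 j : (1 < b)%N ->
  0 < dotC (cis (grid (j%:R + 1))) (vertex j).
Proof.
move=> b1; set u := cis _.
have h0 x : A x -> dotC u x <= dotC u (vertex j) by exact: attractor_halfplane.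
have vN : - dotC u (vertex j) <= dotC u (vertex j).
  by rewrite -dotCN; apply/h0/attractor_opp/vertex_attractor.
rewrite lt_neqAle; apply/andP; split; last lra.
apply/negP => /eqP hE; move: h0; rewrite -hE => h0.
have flat : A `<=` face A (grid (j.+1%:Z)%:~R).
  move=> x Ax; split => // y Ay.
  rewrite -[(j.+1%:Z)%:~R]/(j.+1%:R) -natr1 -/u.
  have := h0 _ Ay; have := h0 _ (attractor_opp Ax); rewrite dotCN; lra.
have [/eqP d0 flat1] := digit_cos_flat flat.
have [/eqP d1 _] := digit_cos_flat flat1.
move: d1; rewrite -[phi]mul1r -[1]/(1%:R) grid_sub shiftE digit_cos_grid_eq0.
rewrite mul1r; move: d0; rewrite digit_cos_grid_eq0 => d0 d1.
have : (b %| gcdz b c)%Z.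
  by rewrite dvdz_gcd dvdzz /= -[c](subKr j.+1%:Z); exact: rpredB.
by rewrite (eqP cop) dvdz1 /= => /eqP bE; rewrite bE in b1.
Qed.

Lemma halfplanes_sub_hull (K : set C) : (1 < b)%N -> convexC K ->
  (forall j, K (vertex j)) ->
  forall y, (forall j, (j < 2 * b)%N ->
    dotC (cis (grid (j%:R + 1))) y <= dotC (cis (grid (j%:R + 1))) (vertex j)) ->
  K y.
Proof.
move=> b1 cK Kv y yH.
(* The origin is the middle of the opposite vertices 0 and [b]. *)
have K0 : K 0.
  have /convexCP/(_ _ _ 2^-1 (Kv 0%N) (Kv b)) := cK.
  rewrite vertexb mulrN (_ : 1 - 2^-1 = 2^-1 :> R); last by field.
  by rewrite subrr; apply; apply/andP; split; lra.
pose g j := crossC (vertex j) y.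
have gb j : g (j + b)%N = - g j by rewrite /g vertexDb crossCN.
(* Since [g] changes sign after [b] steps, the search starts at 0 or at [b], whichever gives a
   non-negative value. *)
have [j jb [g0 g1]] : exists2 j, (j < 2 * b)%N & 0 <= g j /\ g j.+1 <= 0.
  have [g0|g0] := leP 0 (g 0%N).
    have [|j jb gj] := sign_change b_gt0 g0; first by rewrite gb oppr_le0.
    by exists j => //; rewrite (leq_trans jb) // mul2n -addnn leq_addl.
  have gb0E : g b = - g 0%N by rewrite /g vertexb crossCN.
  have gb0 : 0 <= g b by rewrite gb0E oppr_ge0 ltW.
  have [|j jb gj] := sign_change b_gt0 gb0.
    by rewrite gb [g b]gb0E opprK ltW.
  by exists j => //; rewrite mul2n -addnn.
have [L L0 vE] := vertex_edge j.
have h0 := halfplane_height_gt0 j b1; have := yH _ jb.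
set u := cis (grid _) in h0 vE *; set h := dotC u (vertex j) in h0 * => yh.
have crossE : crossC (vertex j) (vertex j.+1) = L * h.
  by rewrite vE crossC_lin crossC_self add0r crossC_cis.
have Lh : 0 < L * h by rewrite mulr_gt0.
have uv1 : dotC u (vertex j.+1) = h.
  apply: face_dotC (vertex_faceS j).
  by have := vertex_face j.+1; rewrite -natr1.
(* Cramer coordinates of [y]. The sign change makes them non-negative, and the inequality of the
   side joining the two vertices bounds their sum by 1. *)
pose a1 := crossC y (vertex j.+1) / (L * h); pose a2 := g j / (L * h).
have yE : y = a1%:C * vertex j + a2%:C * vertex j.+1.
  have := cramer (vertex j) (vertex j.+1) y; rewrite crossE => E.
  have LhN0 : (L * h)%:C != 0 by rewrite eq_complex /= eqxx andbT gt_eqF.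
  apply: (mulfI LhN0); rewrite E mulrDr !mulrA -!(rmorphM (real_complex R)).
  by rewrite /a1 /a2 ![L * h * (_ / _)]mulrC !divfK ?gt_eqF.
have a10 : 0 <= a1.
  by rewrite divr_ge0 ?(ltW Lh) // crossC_anti oppr_ge0.
have a20 : 0 <= a2 by rewrite divr_ge0 // ltW.
rewrite yE; apply: convexC_triangle => //.
by move: yh; rewrite {1}yE dotCD !dotCZ uv1 -mulrDl ger_pMl.
Qed.

(** Otherwise [vertex 0] would be 0, making [A] flat in a direction whose face is a single point,
    although [A] has at least two points. *)
Lemma vertex_neq_opp : vertex 0 != vertex b.
Proof.
rewrite vertexb; apply/negP => /eqP vN.
have v0 : vertex 0 = 0.
  have /eqP : vertex 0 + vertex 0 = 0 by rewrite {1}vN addNr.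
  rewrite -mulr2n -mulr_natl mulf_eq0 => /orP[|/eqP //].
  by rewrite (_ : 2%:R = (2 : R)%:C) ?eq_complex /= ?eqxx ?andbT ?pnatr_eq0 // rmorph_nat.
have flat : A `<=` face A (grid (0%:R + 2^-1)).
  have [_] := vertexP 0; rewrite v0 dotC0 => v0max.
  move=> x Ax; split => // y Ay.
  by have := v0max _ Ay; have := v0max _ (attractor_opp Ax); rewrite dotCN; lra.
have [y Ay] := A_neq0.
have n0 : (0 < n)%N by lia.
have n1 : (1 < n)%N by lia.
have := face_mid_singleton (z := 0) (flat _ (A_ifs n0 Ay)) (flat _ (A_ifs n1 Ay)).
by apply/eqP; exact: ifs_digit_neq.
Qed.

(** When [b = 1] every cosine met along the orbit vanishes, so no digit is ever excluded. *)
Lemma attractor_flat : b = 1%N -> A `<=` face A (grid 0).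
Proof.
move=> b1; have [D _ AD] := compact_normc_bounded A_compact.
suff /(_ 0%N) : forall m : nat, A `<=` face A (grid 0 - m%:R * phi).
  by rewrite mul0r subr0.
apply: (@graph_directed_sub nat succn (fun m k => (k < n)%N) (fun=> A) _ D) => //.
- move=> m k y kn fy; apply: face_ifs; last first.
    by move: fy; rewrite -natr1 mulrDl mul1r opprD addrA.
  apply: optimal_eq0 => //; apply/eqP.
  by rewrite grid_sub (shiftE 0) digit_cos_grid_eq0 b1 dvd1z.
- by move=> m; exact: face_neq0.
- by move=> m; exact: face_closed.
- by move=> m x [/AD|/face_sub_attractor/AD].
Qed.

Lemma attractor_sub_hull (K : set C) : convexC K -> (forall j, K (vertex j)) -> A `<=` K.
Proof.
move=> cK Kv x Ax; have [b1|b1] := leqP b 1; last first.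
  by apply: halfplanes_sub_hull => // j _; exact: attractor_halfplane.
have {}b1 : b = 1%N by lia.
have flat y : A y -> dotC (cis (grid 0)) y = 0.
  move=> Ay; have := face_dotC (attractor_flat b1 Ay) (attractor_flat b1 (attractor_opp Ay)).
  by rewrite dotCN; lra.
set u := cis (grid 0 + 4^-1) : C.
have gE : grid (0%:R + 2^-1) = grid 0 + 4^-1.
  by rewrite /grid b1; field.
have xv : dotC u x <= dotC u (vertex 0).
  by rewrite /u -gE; case: (vertexP 0) => _; exact.
have xv' : - dotC u x <= dotC u (vertex 0).
  by rewrite -dotCN /u -gE; case: (vertexP 0) => _; apply; exact: attractor_opp.
have [v0|v0] := eqVneq (dotC u (vertex 0)) 0.
  have x0 : x = 0.
    rewrite (orthogonal_cis (flat _ Ax)) -/u (_ : dotC u x = 0) ?mul0r //; lra.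
  have vx : vertex 0 = 0.
    by rewrite (orthogonal_cis (flat _ (vertex_attractor 0))) -/u v0 mul0r.
  by rewrite x0 -vx.
have vp : 0 < dotC u (vertex 0) by rewrite lt_neqAle eq_sym v0; lra.
(* For [b = 1] everything lies on a line through 0; [a] is the weight placing [x] between [vertex 0]
   and its opposite. *)
pose a := (dotC u x / dotC u (vertex 0) + 1) / 2.
have aE : dotC u x = (a - (1 - a)) * dotC u (vertex 0) by rewrite /a; field.
have /convexCP/(_ _ _ a (Kv 0%N) (Kv b)) := cK.
rewrite vertexb mulrN -mulrBl -(rmorphB (real_complex R)).
rewrite {1}(orthogonal_cis (flat _ (vertex_attractor 0))) -/u mulrA.
rewrite -(rmorphM (real_complex R)) -aE -orthogonal_cis ?flat //; apply.
have q1 : dotC u x / dotC u (vertex 0) <= 1 by rewrite ler_pdivrMr // mul1r.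
have q2 : -1 <= dotC u x / dotC u (vertex 0) by rewrite ler_pdivlMr // mulN1r lerNl.
by rewrite /a; apply/andP; split; lra.
Qed.

Lemma vertex_mod j : vertex (j %% (2 * b)) = vertex j.
Proof.
rewrite [in RHS](divn_eq j (2 * b)); elim: (j %/ (2 * b))%N => [|k IH].
  by rewrite mul0n add0n.
have D2b i : vertex (i + 2 * b) = vertex i by rewrite mul2n -addnn addnA !vertexDb opprK.
by rewrite (mulSnr k) addnAC D2b.
Qed.

Lemma attractor_polygon : is_polygon (conv_hull A).
Proof.
pose s := undup [seq vertex j | j <- iota 0 (2 * b)].
have b2 : (b < 2 * b)%N by rewrite ltn_Pmull.
have vs j : vertex j \in s.
  rewrite mem_undup -vertex_mod map_f // mem_iota /= add0n ltn_mod.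
  exact: leq_ltn_trans b2.
exists s; split; first exact: undup_uniq.
  apply: (@uniq_leq_size _ [:: vertex 0; vertex b]).
    by rewrite /= inE vertex_neq_opp.
  by move=> x; rewrite !inE => /orP[] /eqP ->.
apply/seteqP; split; apply: conv_hull_sub (@convex_conv_hull _ _) _.
  apply: attractor_sub_hull (@convex_conv_hull _ _) _ => j.
  by apply: sub_conv_hull; exact: vs.
move=> x; rewrite /= mem_undup => /mapP[j _ ->].
apply: sub_conv_hull; exact: vertex_attractor.
Qed.

Lemma conv_hull_interior x : (1 < b)%N ->
  (forall j, dotC (cis (grid (j%:R + 1))) x < dotC (cis (grid (j%:R + 1))) (vertex j)) ->
  interior (conv_hull A) x.
Proof.
move=> b1 xlt.
(* The least slack among the [2 * b] side inequalities is the radius of a ball inside the hull. *)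
have [j _|d d0 dP] := @finite_pos_lb R (2 * b) (fun j =>
  dotC (cis (grid (j%:R + 1))) (vertex j) - dotC (cis (grid (j%:R + 1))) x).
  by rewrite subr_gt0.
apply/nbhs_normc; exists d => // y xy.
apply: halfplanes_sub_hull (@convex_conv_hull _ _) _ _ _ => //.
  by move=> j; apply: sub_conv_hull; exact: vertex_attractor.
move=> j jb; have := dP j jb; have := dotC_normc_le (grid (j%:R + 1)) (y - x).
by rewrite normc_dist dotCB; lra.
Qed.

(** A point of [A] on none of these faces satisfies all side inequalities strictly, so it is
    interior; for [b = 1] the face at [grid 0] is already all of [A]. *)
Lemma ext_attractor : ext A = \bigcup_(j : nat) face A (grid j%:R).
Proof.
apply/seteqP; split => x; last by case=> j _; exact: face_sub_ext.
move=> [Ax [_ xint]]; have [b1|b1] := leqP b 1.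
  by exists 0%N => //; apply: attractor_flat => //; apply/eqP; rewrite eqn_leq b1.
apply: contrapT => no; apply: xint; apply: conv_hull_interior => // j.
rewrite lt_neqAle attractor_halfplane // andbT; apply/negP => /eqP xE; apply: no.
exists j.+1 => //; split => // y Ay.
by rewrite -natr1 xE attractor_halfplane.
Qed.

(** * The system of equations, with indices modulo [2 * b] *)

Let b2_gt1 : (1 < 2 * b)%N.
Proof. by rewrite mul2n -addnn; case: (b) b_gt0 => // k _; rewrite addnS. Qed.

Let cZ : 'Z_(2 * b) := c%:~R.

Definition side (u : 'Z_(2 * b)) : set C := face A (grid (val u)%:R).

(** Links residue indices to integer grid indices: the discrepancy is a whole number of turns,
    invisible to faces. *)
Lemma val_Zp_int (z : int) :
  exists k : int, ((val (z%:~R : 'Z_(2 * b)))%:Z = z + k * (2 * b)%:Z)%R.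
Proof.
have zE := divz_eq z (2 * b)%:Z.
have m0 : 0 <= (z %% (2 * b)%:Z)%Z by rewrite modz_ge0 // eqz_nat; lia.
have mb : (z %% (2 * b)%:Z)%Z < (2 * b)%:Z by rewrite ltz_pmod // ltz_nat; lia.
exists (- (z %/ (2 * b)%:Z)%Z).
have -> : (z%:~R : 'Z_(2 * b)) = (`|(z %% (2 * b)%:Z)%Z|%N)%:R.
  rewrite {1}zE rmorphD rmorphM /= -[X in _ * X + _]/((2 * b)%:R).
  rewrite (_ : (2 * b)%:R = 0 :> 'Z_(2 * b)) ?mulr0 ?add0r; last first.
    by apply: val_inj; rewrite /= val_Zp_nat // modnn.
  by rewrite -{1}(gez0_abs m0).
rewrite /= val_Zp_nat // modn_small; last by rewrite -ltz_nat gez0_abs.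
by rewrite gez0_abs // {2}zE; ring.
Qed.

Lemma side_int (z : int) : side z%:~R = face A (grid z%:~R).
Proof.
rewrite /side; have [k kE] := val_Zp_int z.
rewrite -[(val _)%:R]/((val (z%:~R : 'Z_(2 * b)))%:Z%:~R) kE rmorphD rmorphM /=.
by rewrite -[X in _ * X]/((2 * b)%:R) natrM face_gridDz.
Qed.

Lemma side_sub u : side (u - cZ) = face A (grid (val u)%:R - phi).
Proof.
have -> : u - cZ = ((val u)%:Z - c)%:~R.
  by rewrite rmorphB /= -[X in X - _ = _]natr_Zp.
by rewrite side_int -[phi]mul1r -[1]/(1%:R) grid_sub rmorphB /= mul1r.
Qed.

Lemma val_Zp_small k : (k < 2 * b)%N -> val (k%:R : 'Z_(2 * b)) = k.
Proof. by move=> kb; rewrite /= val_Zp_nat // modn_small. Qed.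

Lemma Zp_cases (u : 'Z_(2 * b)) :
  (exists2 m, (m < 2)%N & u = (m * b)%:R) \/
  (exists m k, [/\ (m < 2)%N, (m * b < k < m.+1 * b)%N & u = k%:R]).
Proof.
have ub : (val u < 2 * b)%N by have := ltn_ord u; rewrite [X in (_ < X)%N](Zp_cast b2_gt1).
have uE : u = (val u)%:R by rewrite natr_Zp.
have m2 : (val u %/ b < 2)%N by rewrite ltn_divLR.
have [r0|r0] := posnP (val u %% b)%N; [left|right].
  by exists (val u %/ b)%N => //; rewrite divnK // /dvdn r0.
exists (val u %/ b)%N, (val u); split => //.
rewrite ltn_ceil // andbT.
by rewrite ltn_neqAle leq_trunc_div andbT -dvdn_eq /dvdn -lt0n.
Qed.

Lemma mid_lt_2b m k : (m < 2)%N -> (m * b < k < m.+1 * b)%N -> (k < 2 * b)%N.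
Proof. by move=> m2 /andP[_ kb]; apply: leq_trans kb _; rewrite leq_mul2r m2 orbT. Qed.

Lemma end_lt_2b m : (m < 2)%N -> (m * b < 2 * b)%N.
Proof. by move=> m2; rewrite ltn_mul2r b_gt0. Qed.

Lemma optimal_end m i : (m < 2)%N ->
  optimal (digit_cos (grid (m * b)%:R)) i <-> (i < n)%N.
Proof.
move=> m2; split=> [[]//|iN]; apply: optimal_eq0 => //; apply/eqP.
by rewrite (digit_cos_grid_eq0 (m * b)%:Z) PoszM dvdz_mull.
Qed.

(** The cosine is negative on the first half of the grid, forcing the last digit, and positive on
    the second half, forcing digit 0, which is [n] modulo [n]. *)
Lemma optimal_inner m k i : (m < 2)%N -> (m * b < k < m.+1 * b)%N ->
  optimal (digit_cos (grid k%:R)) i <-> i = ((n - 1 + m) %% n)%N.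
Proof.
have n0 : (0 < n)%N by exact: leq_trans n_ge2.
case: m => [_ /andP[k0 kb]|[_ /andP[k0 kb]|//]].
  have dn : digit_cos (grid k%:R) < 0.
    apply: digit_cos_grid_lt0; rewrite ltr0n ltr_nat.
    by rewrite mul0n in k0; rewrite mul1n in kb; rewrite k0.
  rewrite addn0 subn1 modn_small ?prednK //.
  split=> [[_ _ /(_ dn)]//|->]; split; rewrite ?prednK //.
  by move=> /(lt_trans dn); rewrite ltxx.
have dp : 0 < digit_cos (grid k%:R).
  rewrite mul1n in k0; rewrite -(subnK (ltnW k0)) natrD -[b%:R]mul1r.
  rewrite -[1]/(1%:~R) digit_cos_gridDb expr1z mulN1r oppr_gt0.
  apply: digit_cos_grid_lt0; rewrite ltr0n subn_gt0 k0 ltr_nat.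
  by rewrite ltn_subLR ?(ltnW k0) // addnn -mul2n.
rewrite addn1 subn1 prednK // modnn.
split=> [[_ /(_ dp)]//|->]; split => //.
by move=> /(lt_trans dp); rewrite ltxx.
Qed.

Lemma edgeP u (i : 'I_n) v : system_edge cZ u i v <->
  optimal (digit_cos (grid (val u)%:R)) i /\ v = u - cZ.
Proof.
split=> [[m m2 [[-> ->]|[k [mk -> iE ->]]]]|[oi ->]].
- split=> //; rewrite val_Zp_small ?end_lt_2b //.
  by apply/optimal_end.
- split=> //; rewrite val_Zp_small ?(mid_lt_2b m2 mk) //.
  by apply/(optimal_inner _ m2 mk).
- have [[m m2 uE]|[m [k [m2 mk uE]]]] := Zp_cases u; exists m => //; first by left; rewrite uE.
  right; exists k; split; rewrite -?uE //; apply/(optimal_inner _ m2 mk).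
  by move: oi; rewrite uE val_Zp_small ?(mid_lt_2b m2 mk).
Qed.

(** Merges the two kinds of equations into one face recursion: the maps allowed at [u] are those
    with an optimal digit. *)
Lemma solves_systemP (B : 'Z_(2 * b) -> set C) : solves_system n f cZ B <->
  forall u, B u = [set x | exists i y,
    [/\ optimal (digit_cos (grid (val u)%:R)) i, B (u - cZ) y & x = f i y]].
Proof.
split=> [sB u|BE m m2].
- have [[m m2 uE]|[m [k [m2 mk uE]]]] := Zp_cases u.
    rewrite {1}uE (sB m m2).1; apply/seteqP; split=> [x [i iN [y By <-]]|x [i [y [oi By ->]]]].
      exists i, y; rewrite {2}uE; split => //.
      by rewrite uE val_Zp_small ?end_lt_2b //; apply/optimal_end.
    exists i; first by case: oi.
    by exists y; rewrite -?uE.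
  rewrite {1}uE ((sB m m2).2 k mk).
  have oE i : optimal (digit_cos (grid (val u)%:R)) i <-> i = ((n - 1 + m) %% n)%N.
    by rewrite uE val_Zp_small ?(mid_lt_2b m2 mk) //; exact: optimal_inner.
  apply/seteqP; split=> [x [y By <-]|x [i [y [/oE -> By ->]]]].
    by exists ((n - 1 + m) %% n)%N, y; split => //; [apply/oE|rewrite uE].
  by exists y; rewrite -?uE.
- split=> [|k mk]; rewrite BE.
    apply/seteqP; split=> [x [i [y [oi By ->]]]|x [i iN [y By <-]]].
      by exists i; [case: oi|exists y].
    exists i, y; split=> //.
    by rewrite val_Zp_small ?end_lt_2b //; apply/optimal_end.
  have oE i : optimal (digit_cos (grid (val (k%:R : 'Z_(2 * b)))%:R)) i <->
      i = ((n - 1 + m) %% n)%N.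
    by rewrite val_Zp_small ?(mid_lt_2b m2 mk) //; exact: optimal_inner.
  apply/seteqP; split=> [x [i [y [/oE -> By ->]]]|x [y By <-]]; first by exists y.
  by exists ((n - 1 + m) %% n)%N, y; split => //; apply/oE.
Qed.

Lemma side_step u : side u = [set x | exists i y,
  [/\ optimal (digit_cos (grid (val u)%:R)) i, side (u - cZ) y & x = f i y]].
Proof.
apply/seteqP; split=> [x /face_ex[i [y [oi fy ->]]]|x [i [y [oi fy ->]]]].
  by exists i, y; rewrite side_sub.
by apply: face_ifs => //; rewrite -side_sub.
Qed.

Lemma side_solution : compact_solution n f cZ side.
Proof.
split; last by apply/solves_systemP; exact: side_step.
by move=> u; split; [exact: face_neq0|exact: face_compact].
Qed.

Lemma solution_sub (B B' : 'Z_(2 * b) -> set C) :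
  compact_solution n f cZ B -> compact_solution n f cZ B' ->
  forall u, B u `<=` B' u.
Proof.
move=> [Bc /solves_systemP BE] [B'c /solves_systemP B'E].
have /choice[D DP] u : exists D : R,
    0 <= D /\ forall x, B u x \/ B' u x -> normc x <= D.
  have [D1 D10 D1P] := compact_normc_bounded (Bc u).2.
  have [D2 D20 D2P] := compact_normc_bounded (B'c u).2.
  exists (D1 + D2); split; first exact: addr_ge0.
  by move=> x [/D1P|/D2P] xD; apply: le_trans xD _; rewrite ?lerDl ?lerDr.
(* The sum of the individual bounds serves as a common bound for all indices. *)
apply: (@graph_directed_sub _ (fun u => u - cZ)
  (fun u => optimal (digit_cos (grid (val u)%:R))) B B' (\sum_u D u)).
- by move=> u x; rewrite {1}BE.
- by move=> u i y oi By; rewrite B'E; exists i, y.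
- by move=> u; case: (B'c u).
- by move=> u; apply: compact_closed (@complex_hausdorff R) (B'c u).2.
- move=> u x /(DP u).2 xD; apply: le_trans xD _.
  rewrite (bigD1 u) //= lerDl sumr_ge0 // => v _; exact: (DP v).1.
Qed.

Lemma solution_uniq B : compact_solution n f cZ B -> B = side.
Proof.
move=> cB; apply/funext => u; apply/seteqP; split;
  by apply: solution_sub => //; exact: side_solution.
Qed.

Lemma ext_sides : ext A = \bigcup_u side u.
Proof.
rewrite ext_attractor; apply/seteqP; split=> [x [j _ fx]|x [u _ fx]].
  by exists j%:~R => //; rewrite side_int.
by exists (val u).
Qed.

(** * Angles of the sides and their number *)

Let corner (k m : nat) : R := mod1 (grid ((k%:Z * c + m%:Z * b%:Z)%:~R)).

(** On the grid, [k * phi] amounts to [k * c] steps and the half turn [m / 2] to [m * b] steps. *)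
Lemma Theta_grid (k m : nat) :
  mod1 (k%:R * phi + (m%:R + 2^-1) * 2^-1 + alpha) = corner k m.
Proof.
by congr mod1; rewrite /grid phiE rmorphD !rmorphM /= -!pmulrn; field.
Qed.

Lemma side_angles_attractor : side_angles (conv_hull A) = Theta b phi alpha.
Proof.
rewrite side_anglesE; apply/seteqP; split=> [t [t01 [x [y [fx fy xy]]]]|t].
- have [j /cos2pi_eq0[k kE]] : exists j : nat, digit_cos (t - j%:R * phi) = 0.
    apply: contrapT => no; move: xy; rewrite (face_singleton _ fx fy) ?eqxx // => j.
    by apply/eqP => d0; apply: no; exists j.
  (* As [b * phi = c / 2], each block of [b] steps is [c] half turns. [q] counts all half turns, and
     its parity is the required [m]. *)
  pose q := k + (j %/ b)%N%:Z * c.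
  have q0 : 0 <= (q %% 2)%Z by rewrite modz_ge0.
  exists (j %% b)%N; first by rewrite /= ltn_mod.
  exists `|(q %% 2)%Z|%N; first by rewrite /= -ltz_nat gez0_abs // ltz_pmod.
  rewrite Theta_grid; symmetry; apply: (@mod1_id _ _ _ (q %/ 2)%Z) => //.
  have jE : j%:R = (j %/ b)%N%:R * b%:R + (j %% b)%N%:R :> R.
    by rewrite -natrM -natrD -divn_eq.
  have qE : q%:~R = (q %/ 2)%Z%:~R * 2 + (q %% 2)%Z%:~R :> R.
    by rewrite {1}(divz_eq q 2) rmorphD rmorphM /=.
  have {}kE : t = alpha + 4^-1 + k%:~R / 2 + j%:R * phi by lra.
  rewrite kE /grid rmorphD !rmorphM /= gez0_abs // -!pmulrn.
  have -> : (q %% 2)%Z%:~R = q%:~R - (q %/ 2)%Z%:~R * 2 :> R by lra.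
  rewrite {1}/q rmorphD rmorphM /= jE phiE -!pmulrn.
  by field.
- case=> k kb [m m2 <-]; rewrite Theta_grid; split; first exact: mod1_itv.
  rewrite /corner; set z := (_ + _)%R; have [x [y [fx fy xy]]] := grid_side z.
  by exists x, y; rewrite /mod1 -rmorphN faceDz.
Qed.

(** The map sending [(k, m)] to [k * c + m * b] is injective modulo [2 * b]: reduction modulo [b]
    recovers [k] because [c] is invertible there, then parity recovers [m]. *)
Lemma card_Theta : (Theta b phi alpha #= `I_(2 * b))%card.
Proof.
pose h l := corner (l %% b) (l %/ b).
have -> : Theta b phi alpha = h @` `I_(2 * b).
  apply/seteqP; split=> [t [k kb [m m2 <-]]|t [l lb <-]].
    exists (m * b + k)%N.
      rewrite /= in kb m2 *; apply: (@leq_trans (m.+1 * b)).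
        by rewrite mulSn addnC ltn_add2r.
      by rewrite leq_mul2r m2 orbT.
    by rewrite Theta_grid /h modnMDl modn_small // divnMDl // divn_small // addn0.
  exists (l %% b)%N; first by rewrite /= ltn_mod.
  exists (l %/ b)%N; first by rewrite /= ltn_divLR.
  by rewrite Theta_grid.
apply: inj_card_eq => l l' /set_mem lb /set_mem lb' /mod1_eq[z].
have m2 : (l %/ b < 2)%N by rewrite ltn_divLR.
have m2' : (l' %/ b < 2)%N by rewrite ltn_divLR.
have ib : (l %% b < b)%N by rewrite ltn_mod.
have ib' : (l' %% b < b)%N by rewrite ltn_mod.
move=> gE; suff [mE iE] : (l %/ b = l' %/ b /\ l %% b = l' %% b)%N.
  by rewrite (divn_eq l b) mE iE -divn_eq.
move: gE.
move: (l %/ b)%N (l' %/ b)%N (l %% b)%N (l' %% b)%N m2 m2' ib ib' => m m' i i' m2 m2' ib ib'.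
pose X := i%:Z * c + m%:Z * b%:Z; pose X' := i'%:Z * c + m'%:Z * b%:Z.
rewrite -/X -/X' => gE.
have {gE} XE : X - X' = z * (2 * b%:Z).
  apply/eqP; rewrite -(eqr_int R) rmorphB !rmorphM /= -[b%:Z%:~R]/(b%:R).
  by apply/eqP; rewrite -gE /grid; field; exact: bN0.
have : (b %| (i%:Z - i'%:Z) * c)%Z.
  apply/dvdzP; exists (z * 2 + m'%:Z - m%:Z).
  have -> : (i%:Z - i'%:Z) * c = X - X' + (m'%:Z - m%:Z) * b by rewrite /X /X'; ring.
  by rewrite XE; ring.
rewrite Gauss_dvdzl // => /dvdzP[u uE].
have iE : i = i'.
  have u0 : u = 0 by clear -uE ib ib'; nia.
  by apply/eqP; rewrite -eqz_nat -subr_eq0 uE u0 mul0r.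
have : (m%:Z - m'%:Z) * b%:Z = z * 2 * b%:Z.
  by rewrite -mulrA -XE /X /X' iE; ring.
move/mulIf => mE; split => //.
have {mE} : m%:Z - m'%:Z = z * 2 by apply: mE; rewrite eqz_nat -lt0n.
by clear -m2 m2'; lia.
Qed.

(* On a side parallel to [w], only every [b]-th digit is free. *)
Lemma side_shrink (z : int) x y :
  face A (grid (z%:~R * b%:R) - phi) x -> face A (grid (z%:~R * b%:R) - phi) y ->
  exists (z' : int) x' y', [/\ face A (grid (z'%:~R * b%:R)) x',
    face A (grid (z'%:~R * b%:R)) y' & r * normc (x - y) = r ^+ b * normc (x' - y')].
Proof.
move=> fx fy; exists (z - c).
have tE j : grid (z%:~R * b%:R) - phi - j%:R * phi = grid (z * b%:Z - j.+1%:Z * c)%:~R.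
  rewrite (_ : _ - _ - _ = grid (z%:~R * b%:R) - j.+1%:R * phi); last by rewrite -natr1; ring.
  by rewrite grid_sub rmorphB !rmorphM.
(* One of the [b] steps is already spent in [- phi], leaving [b.-1] digits; coprimality keeps the
   cosine non-zero for all of them. *)
have [j jb|x' [y' [fx' fy' E]]] := @face_forced b.-1 _ _ _ _ fx fy.
  rewrite tE digit_cos_grid_eq0; apply/negP => bd.
  have : (b %| j.+1%:Z * c)%Z.
    by rewrite -[_ * c](subKr (z * b%:Z)); apply: rpredB => //; exact: dvdz_mull.
  by rewrite Gauss_dvdzl // => /dvdn_leq; rewrite absz_nat => /(_ isT); lia.
have bE : grid (z%:~R * b%:R) - phi - b.-1%:R * phi = grid ((z - c)%:~R * b%:R).
  by rewrite tE prednK // rmorphB !rmorphM /= rmorphB /= -pmulrn; congr grid; ring.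
rewrite bE in fx' fy'; exists x', y'; split => //.
by rewrite E mulrA -exprS prednK.
Qed.

(** One free digit followed by [b.-1] forced ones bounds a distance by [r ^+ b] times another such
    distance plus [2 * n.-1 * W]. Iterating leaves an error [r ^+ b ^+ m * (D + D)] that vanishes in
    the limit. *)
Lemma side_diameter (z : int) x y :
  face A (grid (z%:~R * b%:R)) x -> face A (grid (z%:~R * b%:R)) y ->
  normc (x - y) * (1 - r ^+ b) <= 2 * n.-1%:R * W.
Proof.
have [D D0 AD] := compact_normc_bounded A_compact.
have rb1 : r ^+ b < 1 by rewrite exprn_ilt1 // -lt0n.
have rb0 : 0 <= r ^+ b by rewrite exprn_ge0.
have E0 : 0 <= 2 * n.-1%:R * W by rewrite !mulr_ge0 // ltW.
move=> fx fy; apply: (@le_geom _ (r ^+ b) (D + D)); first by rewrite rb0.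
move=> m; elim: m z x y fx fy => [|m IH] z x y fx fy.
  rewrite expr0 mul1r; have xy : normc (x - y) <= D + D.
    apply: le_trans (normc_triangle _ _) _; rewrite normc_opp.
    by apply: lerD; [move/face_sub_attractor/AD: fx|move/face_sub_attractor/AD: fy].
  have : normc (x - y) * (1 - r ^+ b) <= normc (x - y) * 1.
    by rewrite ler_wpM2l ?normc_ge0 //; lra.
  lra.
have [k [x1 [[kn _ _] fx1 ->]]] := face_ex fx.
have [l [y1 [[ln _ _] fy1 ->]]] := face_ex fy.
have [z' [x' [y' [fx' fy' E]]]] := side_shrink fx1 fy1.
have step : normc (f k x1 - f l y1) <= r ^+ b * normc (x' - y') + 2 * n.-1%:R * W.
  rewrite ifsB; apply: le_trans (normc_triangle _ _) _.
  rewrite !normcM normc_lam normc_w E lerD2l.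
  apply: ler_wpM2r; first exact: ltW.
  rewrite /= expr0n /= addr0 sqrtr_sqr ler_norml coef_dist // andbT lerNl opprB.
  exact: coef_dist.
have := IH _ _ _ fx' fy'; have r1 : 0 <= 1 - r ^+ b by lra.
move=> /(ler_wpM2l rb0) h; apply: le_trans (ler_wpM2r r1 step) _.
rewrite exprS -mulrA; move: h; set N := normc _; set p := r ^+ b.
by set q := p ^+ m; rewrite mulrDr; lra.
Qed.

Lemma convex_ratio : convexC A -> n%:R `^ (- b%:R^-1) <= r.
Proof.
move=> /convex_gap[x [y [fx fy W2]]].
have g0 : alpha + 4^-1 = grid (0%:~R * b%:R) by rewrite /grid !mul0r addr0.
rewrite g0 in fx fy; have [z [x' [y' [fx' fy' E]]]] := side_shrink fx fy.
have := side_diameter fx' fy'; rewrite E in W2.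
have rb1 : r ^+ b < 1 by rewrite exprn_ilt1 // -lt0n.
have rb0 : 0 <= r ^+ b by rewrite exprn_ge0.
move=> /(ler_wpM2l rb0) h.
have {h}h : 2 * W * (1 - r ^+ b) <= r ^+ b * (2 * n.-1%:R * W).
  by apply: le_trans h; rewrite mulrA ler_wpM2r //; lra.
have n1 : n.-1%:R = n%:R - 1 :> R by rewrite -subn1 natrB // ltnW.
(* The gap [2 * W] is at most [r ^+ b] times a distance within a side, so the diameter bound yields
   [1 - r ^+ b <= (n - 1) * r ^+ b]. *)
have nr : 1 <= n%:R * r ^+ b.
  rewrite -(ler_pM2r (_ : 0 < 2 * W)) ?mulr_gt0 //.
  by move: h; rewrite n1; set p := r ^+ b; lra.
have n0 : 0 < n%:R :> R by rewrite ltr0n (ltn_trans _ n_ge2).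
rewrite -(@ler_pXn2r _ b) ?nnegrE ?powR_ge0 //.
rewrite -powR_mulrn ?powR_ge0 // -powRrM mulNr mulVf // powRN powRr1 ?(ltW n0) //.
by rewrite -[X in X <= _]mul1r ler_pdivrMr // mulrC.
Qed.

(** * Boundary points and itineraries of a convex attractor *)

Lemma attractor_boundary : convexC A -> boundary A = ext A.
Proof.
move=> cA; rewrite /ext conv_hull_id //.
by apply/seteqP; split=> x; rewrite /boundary -(closure_id A).1 // => -[].
Qed.

Lemma boundary_itinerary (s : nat -> 'I_n) : convexC A ->
  system_itinerary cZ s <-> exists2 x, boundary A x & is_itinerary f s x.
Proof.
move=> cA; rewrite attractor_boundary // ext_sides.
split=> [[v vE]|[x [u _ fx] sx]].
  have [||||x fx sx] := @itinerary_ex s (fun j => side (v j)).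
  - by move=> j; exact: face_neq0.
  - by move=> j; exact: face_sub_attractor.
  - exact: face_compact.
  - by move=> j x; case/edgeP: (vE j) => oi ->; rewrite side_sub; exact: face_ifs.
  by exists x => //; exists (v 0%N).
(* Every edge subtracts [c], so the path is determined by its start; each shifted itinerary has its
   limit on the corresponding side, which makes its first digit optimal. *)
exists (fun j => u - cZ *+ j) => j; rewrite mulrSr opprD addrA; apply/edgeP; split=> //.
suff [y [fy sy]] : exists y, side (u - cZ *+ j) y /\
    is_itinerary f (fun i => s (j + i)%N) y.
  have [y' yE /itinerary_attractor Ay'] := itinerary_shift sy.
  move: fy; rewrite yE => /face_ifs_inv[]; rewrite ?addn0 //.
elim: j => [|j [y [fy sy]]]; first by exists x; rewrite subr0.
have [y' yE sy'] := itinerary_shift sy.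
have Ay' := itinerary_attractor sy'.
exists y'; split; last first.
  have -> // : (fun i => s (j.+1 + i)%N) = (fun i => s (j + i)%N) \o succn.
  by apply/funext => i /=; rewrite addnS.
rewrite mulrSr opprD addrA side_sub.
by move: fy; rewrite yE => /face_ifs_inv[].
Qed.

End Grid.

(** * Irrational angle *)

Lemma irrational_multiple (m k : int) : irrational phi -> m%:~R * phi = k%:~R / 2 -> m = 0.
Proof.
move=> irr mE; apply/eqP/negP => /negP m0; apply: irr.
exists (k%:~R / (2 * m%:~R)) => //.
rewrite fmorph_div /= rmorphM /= !ratr_int ratr_nat.
have mR0 : m%:~R != 0 :> R by rewrite intr_eq0.
by apply: (mulfI mR0); rewrite mE; field.
Qed.

(** Past the first step no cosine vanishes again, so the face in [convex_gap] is a single point and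
    cannot contain the gap. *)
Lemma irrational_not_convex : irrational phi -> ~ convexC A.
Proof.
move=> irr /convex_gap[x [y [fx fy]]]; apply/negP; rewrite -ltNge.
suff -> : x = y by rewrite subrr normc0 mulr0 mulr_gt0.
apply: face_singleton fx fy => j.
apply/eqP; rewrite /digit_cos => /cos2pi_eq0[k kE].
have /(irrational_multiple irr) : (j.+1%:Z)%:~R * phi = (- k)%:~R / 2.
  have -> : (j.+1%:Z)%:~R = j%:R + 1 :> R by rewrite -pmulrn natr1.
  by rewrite rmorphN /=; lra.
by [].
Qed.

(** Every direction [t j] carries a side, hence a pair of distinct points of [s] orthogonal to it.
    Irrationality makes these directions distinct modulo a half turn, so the pairs are distinct, too
    many for a finite [s]. *)
Lemma irrational_not_polygon : irrational phi -> ~ is_polygon (conv_hull A).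
Proof.
move=> irr [s [_ _ AE]].
pose t (j : nat) := alpha + 4^-1 + j%:R * phi.
have /choice[g gP] (j : nat) : exists g : C * C,
    [/\ g.1 \in s, g.2 \in s, g.1 != g.2 & dotC (cis (t j)) (g.1 - g.2) = 0].
  have tj : digit_cos (t j - j%:R * phi) = 0.
    by rewrite /digit_cos /t (_ : _ - alpha = 4^-1) ?cos2pi_quarter //; ring.
  have [x [y [fx fy xy]]] := face_two_points tj.
  have [|p [p' [fp fp' pp']]] := @side_conv_hull _ [set` s] (t j).
    rewrite -AE; exists x, y; split => //; exact: face_conv_hull.
  exists (p, p'); split => //; [by case: fp|by case: fp'|].
  by rewrite dotCB (face_dotC fp fp') subrr.
have g_inj : injective g.
  move=> i j gij; have [_ _ gN di] := gP i; have [_ _ _ dj] := gP j.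
  rewrite -gij in dj; set d := (g i).1 - (g i).2 in di dj.
  have d0 : d != 0 by rewrite subr_eq0.
  rewrite (orthogonal_cis di) dotCZ dotC_cis in dj.
  move/eqP: dj; rewrite mulf_eq0 => /orP[/eqP L0|/eqP /cos2pi_eq0[k kE]].
    by rewrite (orthogonal_cis di) L0 mul0r eqxx in d0.
  have /(irrational_multiple irr) : (j%:Z - i%:Z)%:~R * phi = (k + 1)%:~R / 2.
    by move: kE; rewrite /t rmorphB rmorphD /= -!pmulrn; lra.
  by move/eqP; rewrite subr_eq0 eqz_nat => /eqP.
have : (size [seq g j | j <- iota 0 (size s * size s).+1] <=
    size [seq (x, y) | x <- s, y <- s])%N.
  apply: uniq_leq_size; first by rewrite map_inj_uniq // iota_uniq.
  move=> _ /mapP[j _ ->]; have [g1 g2 _ _] := gP j.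
  by rewrite [g j]surjective_pairing; apply/allpairsP; exists (g j).
by rewrite size_map size_iota size_allpairs ltnn.
Qed.

End Faces.

Lemma grid_parameters (R : realType) (phi : R) (p : int) (q b d : nat) :
  (1 <= q)%N -> coprime `|p|%N q -> phi = p%:~R / q%:R ->
  (2 * b = lcmn 2 q)%N -> d = gcdn 2 q ->
  [/\ (0 < b)%N, coprimez b ((2 * p) %/ d%:Z)%Z
    & phi = ((2 * p) %/ d%:Z)%Z%:~R / (2 * b%:R)].
Proof.
move=> q0 pq phiE bE dE.
have b0 : (0 < b)%N.
  have : (0 < 2 * b)%N by rewrite bE lcmn_gt0.
  by rewrite muln_gt0.
have q0R : q%:R != 0 :> R by rewrite pnatr_eq0 -lt0n.
have b0R : b%:R != 0 :> R by rewrite pnatr_eq0 -lt0n.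
(* For odd [q], [d = 1], [b = q] and the numerator is [2 * p]; for even [q], [d = 2], [b] is half of
   [q] and the numerator is [p]. *)
have [qodd|qeven] := boolP (odd q).
  have d1 : d = 1%N.
    by rewrite dE; apply/eqP; rewrite -[_ == _]/(coprime 2 q) coprime2n.
  have bq : b = q.
    apply/eqP; rewrite -(eqn_pmul2l (isT : (0 < 2)%N)) bE.
    by have := muln_lcm_gcd 2 q; rewrite -dE d1 muln1 => ->.
  rewrite d1 divz1; split => //; last first.
    by rewrite phiE bq rmorphM /=; field.
  by rewrite bq coprimezE abszM coprimeMr coprimen2 qodd coprime_sym.
have q2 : (2 %| q)%N by rewrite dvdn2.
have d2 : d = 2%N by rewrite dE; apply/gcdn_idPl.
have bq : (2 * b = q)%N by rewrite bE; apply/lcmn_idPr.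
rewrite d2 mulKz //; split => //; last first.
  by rewrite phiE -bq natrM.
rewrite coprimezE coprime_sym.
by move: pq; rewrite -bq coprimeMr => /andP[].
Qed.

Theorem theorem3p4 (R : realType) (n : nat) (w lam : (R[i])^o)
    (phi alpha : R) (A : set (R[i])^o) :
  (2 <= n)%N -> w != 0 -> 0 < `|lam| < 1 ->
  is_attractor n (ifs n lam w) A ->
  lam = `|lam| * cis phi ->
  w = `|w| * cis alpha ->
  (forall (p : int) (q b d : nat),
     (1 <= q)%N -> coprime `|p|%N q -> phi = p%:~R / q%:R ->
     (2 * b = lcmn 2 q)%N -> d = gcdn 2 q ->
     let c : 'Z_(2 * b) := ((2 * p) %/ d%:Z)%Z%:~R in
     [/\ polygon_with_side_angles (conv_hull A) (2 * b) (Theta b phi alpha),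
         exists B : 'Z_(2 * b) -> set (R[i])^o,
           [/\ compact_solution n (ifs n lam w) c B,
               forall B', compact_solution n (ifs n lam w) c B' -> B' = B
             & ext A = \bigcup_j B j]
       & convexC A ->
           (n%:R `^ (- b%:R^-1))%:C <= `|lam| /\
           forall s : nat -> 'I_n,
             system_itinerary c s <->
             exists2 x, boundary A x & is_itinerary (ifs n lam w) s x]) /\
  (irrational phi ->
     ~ is_polygon (conv_hull A) /\ ~ convexC A).
Proof.
move=> n2 w0 lam01 attA lamE wE.
have r01 : 0 < normc lam < 1 by move: lam01; rewrite normrE !ltcR.
have W0 : 0 < normc w.
  by rewrite lt_neqAle normc_ge0 andbT eq_sym; apply: contra w0 => /eqP/eq0_normc ->.
rewrite normrE in lamE; rewrite normrE in wE.
split=> [p q b d q0 pq phiE bE dE c|irr].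
  have [b0 cop phiE'] := grid_parameters q0 pq phiE bE dE.
  split.
  - have sE := side_angles_attractor n2 r01 W0 lamE wE attA b0 cop phiE'.
    split; [exact: (attractor_polygon n2 r01 W0 lamE wE attA b0 cop phiE')|exact: sE|].
    by rewrite sE; exact: (card_Theta _ b0 cop phiE').
  - exists (@side R alpha A b); split.
    + exact: (side_solution n2 r01 W0 lamE wE attA b0 cop phiE').
    + by move=> B'; exact: (solution_uniq n2 r01 W0 lamE wE attA b0 cop phiE').
    + exact: (ext_sides n2 r01 W0 lamE wE attA b0 cop phiE').
  - move=> cA; split.
      by rewrite normrE lecR; exact: (convex_ratio n2 r01 W0 lamE wE attA b0 cop phiE').
    by move=> s; exact: (boundary_itinerary n2 r01 W0 lamE wE attA b0 cop phiE').
split; first exact: (irrational_not_polygon n2 r01 W0 lamE wE attA irr).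
exact: (irrational_not_convex n2 r01 W0 lamE wE attA irr).
Qed.
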